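(* Let $X$ be a compact, locally connected metric space. Then the first singular homology group $H_1(X)$ (with integer coefficients) is either uncountable or isomorphic to a direct sum of finitely many cyclic groups. *)

(* Defs.v *)
From Stdlib Require Import Reals Lra ZArith List Classical ClassicalEpsilon.
Open Scope R_scope.

Definition is_metric {X : Type} (d : X -> X -> R) : Prop :=
  (forall x y, 0 <= d x y) /\
  (forall x y, d x y = 0 <-> x = y) /\
  (forall x y, d x y = d y x) /\
  (forall x y z, d x z <= d x y + d y z).

Definition is_open {X : Type} (d : X -> X -> R) (U : X -> Prop) : Prop :=
  forall x, U x -> exists r, 0 < r /\ forall y, d x y < r -> U y.

Definition metric_compact {X : Type} (d : X -> X -> R) : Prop :=
  forall (J : Type) (U : J -> X -> Prop),
    (forall j, is_open d (U j)) -> (forall x, exists j, U j x) ->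
    exists l : list J, forall x, exists j, In j l /\ U j x.

Definition connected_set {X : Type} (d : X -> X -> R) (S : X -> Prop) : Prop :=
  forall U W : X -> Prop, is_open d U -> is_open d W ->
    (forall x, S x -> U x \/ W x) ->
    (forall x, ~ (S x /\ U x /\ W x)) ->
    (forall x, S x -> U x) \/ (forall x, S x -> W x).

Definition locally_connected {X : Type} (d : X -> X -> R) : Prop :=
  forall (x : X) (U : X -> Prop), is_open d U -> U x ->
    exists V : X -> Prop, is_open d V /\ V x /\ connected_set d V /\
      (forall y, V y -> U y).

Definition stdI := {t : R | 0 <= t <= 1}.
Definition stdD2 := {p : R * R | 0 <= fst p /\ 0 <= snd p /\ fst p + snd p <= 1}.

Lemma I0_prf : 0 <= 0 <= 1. Proof. lra. Qed.
Lemma I1_prf : 0 <= 1 <= 1. Proof. lra. Qed.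
Definition I0 : stdI := exist _ 0 I0_prf.
Definition I1 : stdI := exist _ 1 I1_prf.

(* the standard 2-simplex [e0,e1,e2] with e0=(0,0), e1=(1,0), e2=(0,1) *)
Lemma face0_prf (t : stdI) :
  0 <= fst (1 - proj1_sig t, proj1_sig t) /\ 0 <= snd (1 - proj1_sig t, proj1_sig t)
  /\ fst (1 - proj1_sig t, proj1_sig t) + snd (1 - proj1_sig t, proj1_sig t) <= 1.
Proof. destruct t as [t Ht]; simpl; lra. Qed.
Lemma face1_prf (t : stdI) :
  0 <= fst (0, proj1_sig t) /\ 0 <= snd (0, proj1_sig t)
  /\ fst (0, proj1_sig t) + snd (0, proj1_sig t) <= 1.
Proof. destruct t as [t Ht]; simpl; lra. Qed.
Lemma face2_prf (t : stdI) :
  0 <= fst (proj1_sig t, 0) /\ 0 <= snd (proj1_sig t, 0)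
  /\ fst (proj1_sig t, 0) + snd (proj1_sig t, 0) <= 1.
Proof. destruct t as [t Ht]; simpl; lra. Qed.
(* face0 = [e1,e2], face1 = [e0,e2], face2 = [e0,e1] (affine parametrisations) *)
Definition face0 (t : stdI) : stdD2 := exist _ _ (face0_prf t).
Definition face1 (t : stdI) : stdD2 := exist _ _ (face1_prf t).
Definition face2 (t : stdI) : stdD2 := exist _ _ (face2_prf t).

Definition cont1 {X : Type} (d : X -> X -> R) (s : stdI -> X) : Prop :=
  forall t eps, 0 < eps -> exists delta, 0 < delta /\
    forall t', Rabs (proj1_sig t' - proj1_sig t) < delta -> d (s t') (s t) < eps.

Definition cont2 {X : Type} (d : X -> X -> R) (s : stdD2 -> X) : Prop :=
  forall p eps, 0 < eps -> exists delta, 0 < delta /\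
    forall p', Rabs (fst (proj1_sig p') - fst (proj1_sig p)) < delta ->
               Rabs (snd (proj1_sig p') - snd (proj1_sig p)) < delta ->
               d (s p') (s p) < eps.

(* a chain is a finite list of (coefficient, generator); two lists represent
   the same chain iff all their coefficients agree. *)
Definition coef {A : Type} (l : list (Z * A)) (a : A) : Z :=
  fold_right (fun p acc =>
    ((if excluded_middle_informative (snd p = a) then fst p else 0%Z) + acc)%Z)
    0%Z l.

Definition chain1 (X : Type) := list (Z * (stdI -> X)).
Definition chain2 (X : Type) := list (Z * (stdD2 -> X)).

Definition is_chain1 {X : Type} (d : X -> X -> R) (c : chain1 X) : Prop :=
  forall p, In p c -> cont1 d (snd p).
Definition is_chain2 {X : Type} (d : X -> X -> R) (c : chain2 X) : Prop :=
  forall p, In p c -> cont2 d (snd p).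

Definition bd1 {X : Type} (c : chain1 X) : list (Z * X) :=
  flat_map (fun p => (fst p, snd p I1) :: (Z.opp (fst p), snd p I0) :: nil) c.

Definition bd2 {X : Type} (c : chain2 X) : chain1 X :=
  flat_map (fun p =>
    (fst p, fun t => snd p (face0 t)) ::
    (Z.opp (fst p), fun t => snd p (face1 t)) ::
    (fst p, fun t => snd p (face2 t)) :: nil) c.

Definition is_cycle1 {X : Type} (d : X -> X -> R) (c : chain1 X) : Prop :=
  is_chain1 d c /\ forall x, coef (bd1 c) x = 0%Z.

Definition homologous {X : Type} (d : X -> X -> R) (c1 c2 : chain1 X) : Prop :=
  exists b : chain2 X, is_chain2 d b /\
    forall s, (coef c1 s - coef c2 s)%Z = coef (bd2 b) s.

Definition scale1 {X : Type} (a : Z) (c : chain1 X) : chain1 X :=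
  map (fun p => ((a * fst p)%Z, snd p)) c.

Definition lincomb {X : Type} (k : nat) (g : nat -> chain1 X) (a : nat -> Z)
  : chain1 X := flat_map (fun i => scale1 (a i) (g i)) (seq 0 k).

Definition H1_countable {X : Type} (d : X -> X -> R) : Prop :=
  exists f : nat -> chain1 X, forall c, is_cycle1 d c ->
    exists n, is_cycle1 d (f n) /\ homologous d c (f n).

(* H_1(X;Z) is isomorphic to Z/m_0 ⊕ ... ⊕ Z/m_{k-1} (m_i = 0 meaning Z):
   the map (a_i) |-> [sum a_i g_i] is a well-defined bijective homomorphism
   from ⊕ Z/m_i onto H_1, for some cycles g_0..g_{k-1}. *)
Definition H1_finite_sum_of_cyclic {X : Type} (d : X -> X -> R) : Prop :=
  exists (k : nat) (m : nat -> nat) (g : nat -> chain1 X),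
    (forall i, (i < k)%nat -> is_cycle1 d (g i)) /\
    (forall c, is_cycle1 d c -> exists a : nat -> Z, homologous d c (lincomb k g a)) /\
    (forall a : nat -> Z,
       homologous d (lincomb k g a) nil <->
       (forall i, (i < k)%nat -> Z.divide (Z.of_nat (m i)) (a i))).

(* Main.v *)
(* Suppose first that every point x has a neighbourhood in which all loops at x bound
   in X. A compact, locally connected metric space is uniformly locally
   path-connected, so singular simplices can be cut into small pieces whose end points
   are moved to a finite net; H_1 is then generated by the finitely many loops that
   follow an edge of the net, and the structure theorem applies.

   Otherwise some point x carries loops f_n of diameter tending to 0, none of which
   bounds. A point al of the Cantor space selects a subset of them, and the selected
   loops are concatenated to one loop. If H_1 were countable, the set A of all al whose
   loop lies in some fixed class would be non-meager. A is the projection of a closed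
   set of pairs (al, bounding 2-chain), hence comeager in some cylinder, so that A
   contains two points differing in exactly one coordinate i. The two loops differ by
   f_i, which would therefore bound. *)

From Stdlib Require Import Reals Lra Lia ZArith List Classical ClassicalEpsilon.
From Stdlib Require Import FunctionalExtensionality PropExtensionality.
From Stdlib Require Import Cantor.
From Coquelicot Require Import Rcomplements Compactness.
Require Import Defs.
Import ListNotations.
Open Scope R_scope.

(** * Integer combinations *)

(** In the first case, moving the ends of a small piece to the net costs paths that depend only on
    these end points. Their contribution to a chain is the linear extension of a function of points,
    evaluated on the boundary, so it disappears on cycles. In the second case the obstacle is that
    bounding 2-chains form a large space with no evident topology. It is replaced by a sequence of
    countable codes: first the coefficients, then the simplices up to 2^-k. Chains whose codes
    stabilise converge uniformly, and in the limit distinct generators can only merge, so the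
    equation with the boundary survives. The Baire property of the projection is proved directly
    from these codes. All f_n share the base point x and shrink to it, so they fit into one path; at
    each parameter the concatenated loop depends on a single coordinate of al, hence varies
    continuously with al pointwise. *)

Definition zsum {B : Type} (f : B -> Z) (l : list B) : Z :=
  fold_right (fun b acc => (f b + acc)%Z) 0%Z l.

(** Partially applied, [ind s] is the coefficient function of the chain consisting of the single
    simplex [s]. *)
Definition ind {A : Type} (a b : A) : Z :=
  if excluded_middle_informative (a = b) then 1%Z else 0%Z.

Lemma ind_same {A : Type} (a : A) : ind a a = 1%Z.
Proof. unfold ind; destruct excluded_middle_informative; congruence. Qed.

Lemma ind_diff {A : Type} (a b : A) : a <> b -> ind a b = 0%Z.
Proof. unfold ind; destruct excluded_middle_informative; congruence. Qed.

Lemma zsum_cons {B : Type} (f : B -> Z) b l :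
  zsum f (b :: l) = (f b + zsum f l)%Z.
Proof. reflexivity. Qed.

Lemma zsum_app {B : Type} (f : B -> Z) l1 l2 :
  zsum f (l1 ++ l2) = (zsum f l1 + zsum f l2)%Z.
Proof. induction l1 as [|b l1 IH]; simpl; [reflexivity|rewrite IH; ring]. Qed.

Lemma zsum_ext {B : Type} (f g : B -> Z) l :
  (forall b, In b l -> f b = g b) -> zsum f l = zsum g l.
Proof.
  induction l as [|b l IH]; simpl; intros H; [reflexivity|].
  rewrite (H b), IH; auto.
Qed.

Lemma zsum_scal {B : Type} (z : Z) (f : B -> Z) l :
  zsum (fun b => (z * f b)%Z) l = (z * zsum f l)%Z.
Proof. induction l as [|b l IH]; simpl; [ring|rewrite IH; ring]. Qed.

Lemma zsum_zero {B : Type} (f : B -> Z) l :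
  (forall b, In b l -> f b = 0%Z) -> zsum f l = 0%Z.
Proof.
  induction l as [|b l IH]; simpl; intros H; [reflexivity|].
  rewrite (H b), IH; auto.
Qed.

Lemma zsum_map {A B : Type} (h : A -> B) (f : B -> Z) l :
  zsum f (map h l) = zsum (fun a => f (h a)) l.
Proof. induction l as [|b l IH]; simpl; [reflexivity|rewrite IH; ring]. Qed.

Lemma zsum_flat_map {A B : Type} (h : A -> list B) (f : B -> Z) l :
  zsum f (flat_map h l) = zsum (fun a => zsum f (h a)) l.
Proof.
  induction l as [|b l IH]; simpl; [reflexivity|now rewrite zsum_app, IH].
Qed.

Lemma coef_zsum {A : Type} (l : list (Z * A)) (a : A) :
  coef l a = zsum (fun p => (fst p * ind (snd p) a)%Z) l.
Proof.
  unfold coef, zsum, ind; induction l as [|p l IH]; simpl; [reflexivity|].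
  rewrite IH; destruct excluded_middle_informative; ring.
Qed.

Lemma coef_cons {A : Type} (z : Z) (x : A) l a :
  coef ((z, x) :: l) a = (z * ind x a + coef l a)%Z.
Proof. now rewrite !coef_zsum. Qed.

Lemma coef_nil {A : Type} (a : A) : coef nil a = 0%Z.
Proof. reflexivity. Qed.

Lemma coef_app {A : Type} (l1 l2 : list (Z * A)) a :
  coef (l1 ++ l2) a = (coef l1 a + coef l2 a)%Z.
Proof. rewrite !coef_zsum; apply zsum_app. Qed.

Definition scale {A : Type} (z : Z) (l : list (Z * A)) : list (Z * A) :=
  map (fun p => ((z * fst p)%Z, snd p)) l.

Lemma coef_scale {A : Type} z (l : list (Z * A)) a :
  coef (scale z l) a = (z * coef l a)%Z.
Proof.
  rewrite !coef_zsum, <- zsum_scal; unfold scale; rewrite zsum_map.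
  apply zsum_ext; intros; simpl; ring.
Qed.

Lemma zsum_split_value {A : Type} (F : A -> Z) (a : A) (l : list (Z * A)) :
  zsum (fun p => (fst p * F (snd p))%Z) l =
  (coef l a * F a + zsum (fun p => (fst p * F (snd p))%Z)
     (filter (fun p => if excluded_middle_informative (snd p = a)
                       then false else true) l))%Z.
Proof.
  induction l as [|[z x] l IH]; [reflexivity|].
  rewrite coef_cons, zsum_cons, IH; cbn [filter snd]; unfold ind.
  destruct excluded_middle_informative as [->|n]; [|rewrite zsum_cons];
    cbn [fst snd]; ring.
Qed.

(* A function on generators extends linearly to chains, and a list all of whose
   coefficients vanish represents the zero chain. *)
Lemma zsum_coef_zero {A : Type} (F : A -> Z) (l : list (Z * A)) :
  (forall a, coef l a = 0%Z) -> zsum (fun p => (fst p * F (snd p))%Z) l = 0%Z.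
Proof.
  remember (length l) as n eqn:Hn; revert l Hn.
  induction n as [n IH] using lt_wf_ind; intros [|[z x] l] Hn Hl; [reflexivity|].
  rewrite (zsum_split_value F x), Hl.
  rewrite (IH (length (filter (fun p => if excluded_middle_informative (snd p = x)
      then false else true) ((z, x) :: l)))); [ring| |reflexivity|].
  - cbn [filter snd]. destruct excluded_middle_informative; [|congruence].
    pose proof (filter_length_le (fun p => if excluded_middle_informative (snd p = x)
      then false else true) l). subst n; simpl; lia.
  - intros a. destruct (classic (a = x)) as [->|Hne].
    + rewrite coef_zsum; apply zsum_zero; intros p Hp; apply filter_In in Hp.
      destruct Hp as [_ Hp]; destruct excluded_middle_informative; [discriminate|].
      rewrite ind_diff by assumption; ring.
    + pose proof (zsum_split_value (fun b => ind b a) x ((z, x) :: l)) as H.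
      cbv beta in H; rewrite <- !coef_zsum, !Hl in H. lia.
Qed.

(** * Boundaries *)

(** Being a boundary is made a property of the coefficient function: different lists for one chain
    need no comparison, and identities reduce to [Bd_ext] and pointwise ring equations. *)
Definition Bd {X : Type} (d : X -> X -> R) (phi : (stdI -> X) -> Z) : Prop :=
  exists b : chain2 X, is_chain2 d b /\ forall s, phi s = coef (bd2 b) s.

Lemma coef_bd2_cons {X : Type} z (u : stdD2 -> X) b s :
  coef (bd2 ((z, u) :: b)) s =
  (z * (ind (fun t => u (face0 t)) s - ind (fun t => u (face1 t)) s
        + ind (fun t => u (face2 t)) s) + coef (bd2 b) s)%Z.
Proof.
  unfold bd2; cbn [flat_map]. rewrite coef_app.
  rewrite !coef_cons, coef_nil; cbn [fst snd]; ring.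
Qed.

Lemma coef_bd2_scale {X : Type} z (b : chain2 X) s :
  coef (bd2 (scale z b)) s = (z * coef (bd2 b) s)%Z.
Proof.
  induction b as [|[w u] b IH]; [unfold coef; simpl; ring|].
  change (scale z ((w, u) :: b)) with (((z * w)%Z, u) :: scale z b).
  rewrite !coef_bd2_cons, IH; ring.
Qed.

Section Boundaries.
Context {X : Type} (d : X -> X -> R).
Implicit Types phi psi : (stdI -> X) -> Z.

Lemma Bd_ext phi psi : Bd d phi -> (forall s, phi s = psi s) -> Bd d psi.
Proof.
  intros (b & Hb & H) E; exists b; split; [exact Hb|].
  intros s; rewrite <- E; apply H.
Qed.

Lemma Bd_zero : Bd d (fun _ => 0%Z).
Proof. exists nil; split; [intros p []|reflexivity]. Qed.

Lemma Bd_add phi psi : Bd d phi -> Bd d psi -> Bd d (fun s => (phi s + psi s)%Z).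
Proof.
  intros (b & Hb & H) (b' & Hb' & H'); exists (b ++ b'); split.
  - intros p Hp; apply in_app_or in Hp as [Hp|Hp]; auto.
  - intros s; unfold bd2; rewrite flat_map_app, coef_app, H, H'; reflexivity.
Qed.

Lemma Bd_scal z phi : Bd d phi -> Bd d (fun s => (z * phi s)%Z).
Proof.
  intros (b & Hb & H); exists (scale z b); split.
  - intros p Hp; apply in_map_iff in Hp as (q & <- & Hq); exact (Hb q Hq).
  - intros s; rewrite coef_bd2_scale, H; reflexivity.
Qed.

Lemma Bd_sub phi psi : Bd d phi -> Bd d psi -> Bd d (fun s => (phi s - psi s)%Z).
Proof.
  intros H H'; apply (Bd_ext (fun s => (phi s + -1 * psi s)%Z)).
  - apply Bd_add; [exact H|exact (Bd_scal (-1) _ H')].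
  - intros; ring.
Qed.

End Boundaries.

(** * Paths *)

(** Paths live on the whole line: reparametrisations then carry no membership proofs, and
    [seg f a b] may run backwards or be degenerate. *)
Definition cpath {X : Type} (d : X -> X -> R) (f : R -> X) : Prop :=
  forall t eps, 0 < eps -> exists delta, 0 < delta /\
    forall t', Rabs (t' - t) < delta -> d (f t') (f t) < eps.

Definition seg {X : Type} (f : R -> X) (a b : R) : stdI -> X :=
  fun t => f (a + proj1_sig t * (b - a)).

Definition clamp (t : R) : R := Rmax 0 (Rmin 1 t).

Lemma clamp_bounds t : 0 <= clamp t <= 1.
Proof. unfold clamp, Rmax, Rmin; repeat destruct Rle_dec; lra. Qed.

Lemma clamp_id t : 0 <= t <= 1 -> clamp t = t.
Proof. unfold clamp, Rmax, Rmin; repeat destruct Rle_dec; lra. Qed.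

Lemma clamp_le0 t : t <= 0 -> clamp t = 0.
Proof. unfold clamp, Rmax, Rmin; repeat destruct Rle_dec; lra. Qed.

Lemma clamp_ge1 t : 1 <= t -> clamp t = 1.
Proof. unfold clamp, Rmax, Rmin; repeat destruct Rle_dec; lra. Qed.

Lemma clamp_lip t t' : Rabs (clamp t' - clamp t) <= Rabs (t' - t).
Proof.
  unfold clamp, Rmax, Rmin, Rabs; repeat destruct Rle_dec;
    repeat destruct Rcase_abs; lra.
Qed.

Definition toI (t : R) : stdI := exist _ (clamp t) (clamp_bounds t).

Lemma stdI_eq (s t : stdI) : proj1_sig s = proj1_sig t -> s = t.
Proof.
  destruct s as [s Hs], t as [t Ht]; simpl; intros ->; f_equal; apply proof_irrelevance.
Qed.

Lemma toI_proj (t : stdI) : toI (proj1_sig t) = t.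
Proof. apply stdI_eq; simpl; apply clamp_id; exact (proj2_sig t). Qed.

Lemma toI_0 : toI 0 = I0.
Proof. apply stdI_eq; simpl; apply clamp_id; lra. Qed.

Lemma toI_1 : toI 1 = I1.
Proof. apply stdI_eq; simpl; apply clamp_id; lra. Qed.

Lemma seg_ext {X : Type} (f g : R -> X) a b a' b' :
  (forall t, 0 <= t <= 1 -> f (a + t * (b - a)) = g (a' + t * (b' - a'))) ->
  seg f a b = seg g a' b'.
Proof. intros H; apply functional_extensionality; intros [t Ht]; apply H, Ht. Qed.

Section Paths.
Context {X : Type} (d : X -> X -> R) (hmet : is_metric d).

Lemma met_pos x y : 0 <= d x y. Proof. apply hmet. Qed.
Lemma met_refl x : d x x = 0. Proof. now apply hmet. Qed.
Lemma met_eq x y : d x y = 0 -> x = y. Proof. apply hmet. Qed.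
Lemma met_sym x y : d x y = d y x. Proof. apply hmet. Qed.
Lemma met_tri x y z : d x z <= d x y + d y z. Proof. apply hmet. Qed.

Lemma cpath_const x : cpath d (fun _ => x).
Proof. intros t eps He; exists 1; split; [lra|intros; rewrite met_refl; lra]. Qed.

Lemma cpath_comp (f : R -> X) (g : R -> R) L :
  0 < L -> (forall t t', Rabs (g t' - g t) <= L * Rabs (t' - t)) ->
  cpath d f -> cpath d (fun t => f (g t)).
Proof.
  intros HL Hg Hf t eps He; destruct (Hf (g t) eps He) as (de & Hde & H).
  exists (de / L); split; [apply Rdiv_lt_0_compat; lra|].
  intros t' Ht; apply H; apply Rle_lt_trans with (1 := Hg t t').
  apply Rmult_lt_reg_r with (/ L); [apply Rinv_0_lt_compat; lra|].
  unfold Rdiv in Ht; replace (L * Rabs (t' - t) * / L) with (Rabs (t' - t)) by (field; lra).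
  exact Ht.
Qed.

Lemma cpath_affine (f : R -> X) (a b : R) : cpath d f -> cpath d (fun t => f (a + t * b)).
Proof.
  apply (cpath_comp f (fun t => a + t * b) (Rabs b + 1)).
  - pose proof (Rabs_pos b); lra.
  - intros t t'; replace (a + t' * b - (a + t * b)) with ((t' - t) * b) by ring.
    rewrite Rabs_mult; pose proof (Rabs_pos (t' - t)); nra.
Qed.

Lemma cpath_clamp f : cpath d f -> cpath d (fun t => f (clamp t)).
Proof.
  apply cpath_comp with 1; [lra|]; intros; rewrite Rmult_1_l; apply clamp_lip.
Qed.

Lemma cont1_seg (f : R -> X) a b : cpath d f -> cont1 d (seg f a b).
Proof.
  intros Hf t eps He.
  destruct (cpath_affine f a (b - a) Hf (proj1_sig t) eps He) as (de & Hde & H).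
  exists de; split; [exact Hde|]; intros t' Ht; exact (H _ Ht).
Qed.

Lemma cpath_toI (s : stdI -> X) : cont1 d s -> cpath d (fun t => s (toI t)).
Proof.
  intros Hs t eps He; destruct (Hs (toI t) eps He) as (de & Hde & H).
  exists de; split; [exact Hde|]; intros t' Ht; apply H; simpl.
  apply Rle_lt_trans with (1 := clamp_lip t t'); exact Ht.
Qed.

Lemma seg_toI (s : stdI -> X) : seg (fun t => s (toI t)) 0 1 = s.
Proof.
  apply functional_extensionality; intros t; unfold seg.
  rewrite <- (toI_proj t) at 2; do 2 f_equal; ring.
Qed.

(** The affine map from the triangle to the line with vertices at [a], [b], [c], followed by [f], is
    a singular 2-simplex with these faces. As the three may come in any order, this covers
    subdivision, reversal and degenerate simplices. *)
Lemma Bd_triangle (f : R -> X) a b c : cpath d f ->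
  Bd d (fun s => (ind (seg f a b) s + ind (seg f b c) s - ind (seg f a c) s)%Z).
Proof.
  intros Hf.
  set (u := fun p : stdD2 =>
    f (a + fst (proj1_sig p) * (b - a) + snd (proj1_sig p) * (c - a))).
  exists [(1%Z, u)]; split.
  - intros p [<-|[]]; simpl; intros q eps He.
    destruct (Hf (a + fst (proj1_sig q) * (b - a) + snd (proj1_sig q) * (c - a)) eps He)
      as (de & Hde & H).
    set (L := Rabs (b - a) + Rabs (c - a) + 1).
    assert (HL : 0 < L) by (unfold L; pose proof (Rabs_pos (b - a));
      pose proof (Rabs_pos (c - a)); lra).
    exists (de / L); split; [apply Rdiv_lt_0_compat; lra|].
    intros q' H1 H2; apply H.
    replace (_ - _) with
      ((fst (proj1_sig q') - fst (proj1_sig q)) * (b - a)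
       + (snd (proj1_sig q') - snd (proj1_sig q)) * (c - a)) by ring.
    apply Rle_lt_trans with (1 := Rabs_triang _ _); rewrite !Rabs_mult.
    assert (H0 : 0 < de / L) by (apply Rdiv_lt_0_compat; lra).
    replace de with (de / L * L) by (field; lra).
    unfold L at 2; pose proof (Rabs_pos (b - a)); pose proof (Rabs_pos (c - a)).
    pose proof (Rabs_pos (fst (proj1_sig q') - fst (proj1_sig q))).
    pose proof (Rabs_pos (snd (proj1_sig q') - snd (proj1_sig q))). nra.
  - intros s; rewrite coef_bd2_cons; change (coef (bd2 nil) s) with 0%Z.
    replace (fun t => u (face0 t)) with (seg f b c);
      [replace (fun t => u (face1 t)) with (seg f a c);
        [replace (fun t => u (face2 t)) with (seg f a b); [ring|]|]|];
      apply functional_extensionality; intros [t Ht]; unfold seg, u; simpl; f_equal; ring.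
Qed.

Lemma Bd_seg_same f a : cpath d f -> Bd d (fun s => ind (seg f a a) s).
Proof.
  intros Hf; apply (Bd_ext d _ _ (Bd_triangle f a a a Hf)); intros; ring.
Qed.

Lemma Bd_const x : Bd d (fun s => ind (fun _ : stdI => x) s).
Proof.
  apply (Bd_ext d _ _ (Bd_seg_same (fun _ => x) 0 (cpath_const x))); reflexivity.
Qed.

(** A single path in [S] represents [phi] modulo boundaries. Chains then concatenate by addition,
    and what is known for single loops applies to closed chains made of several simplices. *)
Definition chain_path (S : X -> Prop) (x y : X) (phi : (stdI -> X) -> Z) : Prop :=
  exists f, cpath d f /\ f 0 = x /\ f 1 = y /\ (forall t, S (f t)) /\
    Bd d (fun s => (ind (seg f 0 1) s - phi s)%Z).

Lemma chain_path_seg (S : X -> Prop) (f : R -> X) a b : cpath d f ->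
  (forall t, 0 <= t <= 1 -> S (f (a + t * (b - a)))) ->
  chain_path S (f a) (f b) (ind (seg f a b)).
Proof.
  intros Hf HS; exists (fun t => f (a + clamp t * (b - a))).
  split; [apply (cpath_clamp (fun t => f (a + t * (b - a)))), cpath_affine, Hf|].
  split; [f_equal; rewrite clamp_id by lra; ring|].
  split; [f_equal; rewrite clamp_id by lra; ring|].
  split; [intros t; apply HS, clamp_bounds|].
  apply (Bd_ext d _ _ (Bd_zero d)); intros s.
  rewrite (seg_ext _ f 0 1 a b); [ring|].
  intros t Ht; rewrite clamp_id by lra; do 3 f_equal; ring.
Qed.

Lemma chain_path_rev S x y phi :
  chain_path S x y phi -> chain_path S y x (fun s => (- phi s)%Z).
Proof.
  intros (f & Hf & H0 & H1 & HS & HB); exists (fun t => f (1 + t * (-1))).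
  split; [now apply cpath_affine|].
  split; [rewrite <- H1; f_equal; ring|].
  split; [rewrite <- H0; f_equal; ring|].
  split; [intros; apply HS|].
  rewrite (seg_ext _ f 0 1 1 0) by (intros; f_equal; ring).
  (* The degenerate triangle with vertices 0, 1, 0 makes a path and its reverse cancel up to a
     constant simplex, itself a boundary. *)
  apply (Bd_ext d (fun s => ((ind (seg f 0 1) s + ind (seg f 1 0) s - ind (seg f 0 0) s)
     + ind (seg f 0 0) s - (ind (seg f 0 1) s - phi s))%Z)); [|intros; ring].
  apply Bd_sub; [apply Bd_add; [now apply Bd_triangle|now apply Bd_seg_same]|exact HB].
Qed.

Lemma chain_path_concat S x y z phi psi :
  chain_path S x y phi -> chain_path S y z psi ->
  chain_path S x z (fun s => (phi s + psi s)%Z).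
Proof.
  intros (f & Hf & Hf0 & Hf1 & HfS & HfB) (g & Hg & Hg0 & Hg1 & HgS & HgB).
  set (F := fun t => f (clamp (0 + t * 2))).
  set (G := fun t => g (clamp (-1 + t * 2))).
  assert (HF : cpath d F)
    by (apply (cpath_affine (fun t => f (clamp t))), cpath_clamp, Hf).
  assert (HG : cpath d G)
    by (apply (cpath_affine (fun t => g (clamp t))), cpath_clamp, Hg).
  assert (HFy : forall t, / 2 <= t -> F t = y)
    by (intros t Ht; unfold F; rewrite clamp_ge1 by lra; exact Hf1).
  assert (HGy : forall t, t <= / 2 -> G t = y)
    by (intros t Ht; unfold G; rewrite clamp_le0 by lra; exact Hg0).
  (* Each half continues as the constant [y] across the cut, so values on different sides of 1/2 are
     both compared with [y]. *)
  set (h := fun t => if Rle_dec t (/ 2) then F t else G t).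
  assert (Hh : cpath d h).
  { intros t eps He.
    destruct (HF t (eps / 2)) as (d1 & Hd1 & H1); [lra|].
    destruct (HG t (eps / 2)) as (d2 & Hd2 & H2); [lra|].
    exists (Rmin d1 d2); split; [apply Rmin_pos; assumption|].
    intros t' Ht.
    specialize (H1 t' (Rlt_le_trans _ _ _ Ht (Rmin_l _ _))).
    specialize (H2 t' (Rlt_le_trans _ _ _ Ht (Rmin_r _ _))).
    unfold h; destruct (Rle_dec t' (/ 2)), (Rle_dec t (/ 2)); try lra.
    - rewrite (HFy t) in H1 by lra; rewrite (HGy t') in H2 by lra.
      pose proof (met_tri (F t') y (G t)); lra.
    - rewrite (HFy t') in H1 by lra; rewrite (HGy t) in H2 by lra.
      pose proof (met_tri (G t') y (F t)); lra. }
  exists h; split; [exact Hh|]; unfold h.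
  split; [destruct Rle_dec; [|lra]; unfold F; rewrite clamp_le0 by lra; exact Hf0|].
  split; [destruct Rle_dec; [lra|]; unfold G; rewrite clamp_ge1 by lra; exact Hg1|].
  split; [intros t; destruct Rle_dec; [apply HfS|apply HgS]|].
  fold h; apply (Bd_ext d (fun s => ((ind (seg f 0 1) s - phi s) + (ind (seg g 0 1) s - psi s)
    - (ind (seg h 0 (/ 2)) s + ind (seg h (/ 2) 1) s - ind (seg h 0 1) s))%Z)).
  - apply Bd_sub; [now apply Bd_add|now apply Bd_triangle].
  - intros s.
    rewrite (seg_ext h f 0 (/ 2) 0 1), (seg_ext h g (/ 2) 1 0 1); [ring| |].
    + intros t Ht; unfold h; destruct Rle_dec.
      * rewrite HFy, <- Hg0 by lra; f_equal; lra.
      * unfold G; f_equal; rewrite clamp_id by lra; lra.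
    + intros t Ht; unfold h; destruct Rle_dec; [|lra].
      unfold F; f_equal; rewrite clamp_id by lra; lra.
Qed.

Lemma chain_path_mono (S S' : X -> Prop) x y phi :
  (forall z, S z -> S' z) -> chain_path S x y phi -> chain_path S' x y phi.
Proof.
  intros HS (f & Hf & H0 & H1 & H2 & HB); exists f; repeat split; auto.
Qed.

End Paths.

(** * Compactness and local path-connectedness *)

Lemma list_bound {A : Type} (k : A -> nat) (l : list A) :
  exists K, forall x, In x l -> (k x <= K)%nat.
Proof.
  induction l as [|a l [K HK]]; [exists 0%nat; intros x []|].
  exists (Nat.max (k a) K); intros x [<-|H]; [lia|]. specialize (HK x H); lia.
Qed.

Lemma list_pos_lower_bound {A : Type} (r : A -> R) (l : list A) :
  (forall x, 0 < r x) -> exists m, 0 < m /\ forall x, In x l -> m <= r x.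
Proof.
  intros Hr; induction l as [|a l (m & Hm & H)]; [exists 1; split; [lra|intros x []]|].
  exists (Rmin (r a) m); split; [now apply Rmin_pos|].
  intros x [<-|Hx]; [apply Rmin_l|].
  apply Rle_trans with m; [apply Rmin_r|now apply H].
Qed.

Lemma dependent_choice {A : Type} (inv : nat -> A -> Prop) (step : nat -> A -> A -> Prop) a0 :
  inv 0%nat a0 ->
  (forall k a, inv k a -> exists a', inv (S k) a' /\ step k a a') ->
  exists u : nat -> A, u 0%nat = a0 /\
    forall k, inv k (u k) /\ step k (u k) (u (S k)).
Proof.
  intros H0 Hs.
  assert (Hn : forall ka : nat * A, exists a', inv (fst ka) (snd ka) ->
    inv (S (fst ka)) a' /\ step (fst ka) (snd ka) a').
  { intros [k a]; destruct (classic (inv k a)) as [H|H].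
    - destruct (Hs k a H) as [a' Ha']; exists a'; auto.
    - exists a; intros; contradiction. }
  apply choice in Hn as [nxt Hn].
  set (u := fix u k := match k with O => a0 | S k => nxt (k, u k) end).
  assert (Hi : forall k, inv k (u k))
    by (induction k as [|k IH]; [exact H0|exact (proj1 (Hn (k, u k) IH))]).
  exists u; split; [reflexivity|]; intros k; split; [apply Hi|].
  exact (proj2 (Hn (k, u k) (Hi k))).
Qed.

Lemma half_pow_pos k : 0 < (1 / 2) ^ k.
Proof. apply pow_lt; lra. Qed.

Lemma half_pow_small e eps : 0 < e -> 0 < eps -> exists k, e * (1 / 2) ^ k < eps.
Proof.
  intros He Heps; destruct (pow_lt_1_zero (1 / 2)) with (y := eps / e) as [k Hk].
  - rewrite Rabs_pos_eq; lra.
  - now apply Rdiv_lt_0_compat.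
  - exists k; specialize (Hk k (Nat.le_refl k)).
    rewrite Rabs_pos_eq in Hk by (left; apply half_pow_pos).
    apply Rmult_lt_compat_l with (r := e) in Hk; [|lra].
    replace (e * (eps / e)) with eps in Hk by (field; lra); exact Hk.
Qed.

(** * Integer parts and indices of subdivisions *)

Definition nfl (x : R) : nat := Z.to_nat (Int_part x).

Lemma nfl_spec x : 0 <= x -> INR (nfl x) <= x < INR (nfl x) + 1.
Proof.
  intros Hx; unfold nfl; destruct (base_Int_part x) as [H1 H2].
  assert (0 <= Int_part x)%Z.
  { apply le_IZR.
    destruct (Z_lt_le_dec (Int_part x) 0) as [H|H]; [|now apply IZR_le].
    assert (H3 : (Int_part x <= -1)%Z) by lia; apply IZR_le in H3; lra. }
  rewrite INR_IZR_INZ, Z2Nat.id by assumption; lra.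
Qed.

Lemma nfl_unique x i : INR i <= x < INR i + 1 -> nfl x = i.
Proof.
  intros [H1 H2]; pose proof (pos_INR i).
  destruct (nfl_spec x) as [H3 H4]; [lra|].
  assert (H5 : INR (nfl x) < INR (S i)) by (rewrite S_INR; lra).
  assert (H6 : INR i < INR (S (nfl x))) by (rewrite S_INR; lra).
  apply INR_lt in H5, H6; lia.
Qed.

(** When a chain is refined by a factor [N], the coarse index belonging to a parameter is the
    quotient of the fine index; successive approximations of a path are compared through this. *)
Lemma nfl_div x N : 0 <= x -> (1 <= N)%nat -> nfl x = (nfl (x * INR N) / N)%nat.
Proof.
  intros Hx HN; apply nfl_unique.
  assert (HN' : 1 <= INR N) by (change 1 with (INR 1); now apply le_INR).
  set (j := nfl (x * INR N)).
  destruct (nfl_spec (x * INR N)) as [H1 H2]; [nra|]; fold j in H1, H2.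
  pose proof (Nat.div_mod j N ltac:(lia)) as Hj.
  pose proof (Nat.mod_upper_bound j N ltac:(lia)) as Hm.
  set (i := (j / N)%nat) in *; set (r := (j mod N)%nat) in *.
  assert (H3 : INR j = INR N * INR i + INR r) by (rewrite Hj, plus_INR, mult_INR; ring).
  assert (H4 : INR r + 1 <= INR N) by (rewrite <- S_INR; apply le_INR; lia).
  pose proof (pos_INR r).
  split; [apply Rmult_le_reg_r with (INR N)|apply Rmult_lt_reg_r with (INR N)]; nra.
Qed.

Lemma div_mod_succ j N : (1 <= N)%nat ->
  (S (j mod N) < N /\ S j / N = j / N /\ S j mod N = S (j mod N) \/
   S (j mod N) = N /\ S j / N = S (j / N) /\ S j mod N = 0)%nat.
Proof.
  intros HN.
  pose proof (Nat.div_mod j N ltac:(lia)) as Hj.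
  pose proof (Nat.mod_upper_bound j N ltac:(lia)) as Hm.
  destruct (Nat.eq_dec (S (j mod N)) N) as [E|E]; [right|left].
  - split; [exact E|]; split; symmetry;
      [apply Nat.div_unique with 0%nat|apply Nat.mod_unique with (S (j / N))]; nia.
  - assert (S (j mod N) < N)%nat by lia; split; [assumption|]; split; symmetry;
      [apply Nat.div_unique with (S (j mod N))|apply Nat.mod_unique with (j / N)%nat]; lia.
Qed.

Section Topology.
Context {X : Type} (d : X -> X -> R).
Context (hmet : is_metric d) (hcpt : metric_compact d) (hlc : locally_connected d).
Local Notation dpos := (met_pos d hmet).
Local Notation drefl := (met_refl d hmet).
Local Notation dsym := (met_sym d hmet).
Local Notation dtri := (met_tri d hmet).

Lemma open_ball x r : is_open d (fun y => d x y < r).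
Proof.
  intros y Hy; exists (r - d x y); split; [lra|].
  intros z Hz; pose proof (dtri x y z); lra.
Qed.

Lemma compact_cover (r : X -> R) : (forall x, 0 < r x) ->
  exists l : list X, forall y, exists x, In x l /\ d x y < r x.
Proof.
  intros Hr; apply (hcpt X (fun x y => d x y < r x)).
  - intros x; apply open_ball.
  - intros x; exists x; rewrite drefl; apply Hr.
Qed.

Lemma lebesgue_number (r : X -> R) : (forall x, 0 < r x) ->
  exists la, 0 < la /\ forall y, exists x, forall z, d y z < la -> d x z < r x.
Proof.
  intros Hr; destruct (compact_cover (fun x => r x / 2)) as [l Hl].
  { intros x; specialize (Hr x); lra. }
  destruct (list_pos_lower_bound (fun x => r x / 2) l) as (m & Hm & H).
  { intros x; specialize (Hr x); lra. }
  exists m; split; [exact Hm|]; intros y; destruct (Hl y) as (x & Hx & Hy).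
  exists x; intros z Hz; specialize (H x Hx); pose proof (dtri x y z); simpl in *; lra.
Qed.

(** Completeness from compactness. If no point were a limit, each [x] would exceed the tail bound at
    some index [k x]. The balls whose radius is this excess cover the space, but a term of the
    sequence beyond the indices of a finite subcover lies in none of its balls. *)
Lemma geometric_limit (u : nat -> X) e : 0 < e ->
  (forall k, d (u k) (u (S k)) <= e * (1 / 2) ^ k) ->
  exists x, forall k, d (u k) x <= 2 * e * (1 / 2) ^ k.
Proof.
  intros He Hu.
  assert (Hkj : forall k n, d (u k) (u (k + n)%nat) <= 2 * e * ((1 / 2) ^ k - (1 / 2) ^ (k + n))).
  { intros k n; induction n as [|n IH].
    - rewrite Nat.add_0_r, drefl; lra.
    - rewrite Nat.add_succ_r; specialize (Hu (k + n)%nat).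
      pose proof (dtri (u k) (u (k + n)%nat) (u (S (k + n)))).
      simpl pow; lra. }
  apply NNPP; intros Hno.
  assert (Hx : forall x, exists k, 2 * e * (1 / 2) ^ k < d (u k) x).
  { intros x; apply NNPP; intros H; apply Hno; exists x; intros k.
    destruct (Rle_or_lt (d (u k) x) (2 * e * (1 / 2) ^ k)); [assumption|].
    exfalso; apply H; exists k; assumption. }
  apply choice in Hx as [k Hk].
  destruct (compact_cover (fun x => d (u (k x)) x - 2 * e * (1 / 2) ^ k x)) as [l Hl].
  { intros x; specialize (Hk x); lra. }
  destruct (list_bound k l) as [K HK].
  destruct (Hl (u K)) as (x & Hx & Hd); specialize (HK x Hx).
  specialize (Hkj (k x) (K - k x)%nat).
  replace (k x + (K - k x))%nat with K in Hkj by lia.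
  pose proof (dtri (u (k x)) (u K) x); rewrite (dsym (u K) x) in H.
  pose proof (half_pow_pos K); nra.
Qed.

Lemma met_eq_of_small x y e : (forall k, d x y <= e * (1 / 2) ^ k) -> x = y.
Proof.
  intros H; apply (met_eq d hmet).
  destruct (Rle_lt_or_eq_dec _ _ (dpos x y)) as [Hp|Hp]; [exfalso|auto].
  pose proof (H 0%nat); simpl in *.
  destruct (half_pow_small e (d x y)) as [k Hk]; [lra|assumption|].
  specialize (H k); lra.
Qed.

(** A link is a step of a discrete path. It comes with an open connected set, inside which it can be
    refined to shorter links. *)
Definition linked (e : R) (x y : X) : Prop :=
  exists V, is_open d V /\ connected_set d V /\ V x /\ V y /\
    forall a b, V a -> V b -> d a b < e.

Lemma linked_near e x : 0 < e -> exists r, 0 < r /\ forall y z, d x y < r -> d x z < r ->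
  linked e y z.
Proof.
  intros He.
  destruct (hlc x (fun y => d x y < e / 2) (open_ball x _)) as (V & Vo & Vx & Vc & HV).
  { rewrite drefl; lra. }
  destruct (Vo x Vx) as (r & Hr & H); exists r; split; [exact Hr|].
  intros y z Hy Hz; exists V; repeat split; auto.
  intros a b Ha Hb; apply HV in Ha, Hb; pose proof (dtri a x b).
  rewrite (dsym a x) in H0; lra.
Qed.

Lemma linked_refl e x : 0 < e -> linked e x x.
Proof.
  intros He; destruct (linked_near e x He) as (r & Hr & H); apply H; rewrite drefl; exact Hr.
Qed.

(* The points reachable from [p] by steps inside [V] form a set that is open and
   has open complement in [V]. *)
Lemma chain_connected V e p q : is_open d V -> connected_set d V -> 0 < e -> V p -> V q ->
  exists n c, c 0%nat = p /\ (forall r, (n <= r)%nat -> c r = q) /\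
    forall r, V (c r) /\ linked e (c r) (c (S r)).
Proof.
  intros Vo Vc He Hp Hq.
  set (reach := fun q => exists n (c : nat -> X), c 0%nat = p /\
    (forall r, (n <= r)%nat -> c r = q) /\
    forall r, V (c r) /\ linked e (c r) (c (S r))).
  assert (Hstep : forall y z, reach y -> V z -> linked e y z -> reach z).
  { intros y z (n & c & H0 & Hn & Hc) Hz Hyz.
    exists (S n), (fun r => if le_lt_dec r n then c r else z); split; [|split].
    - destruct le_lt_dec; [exact H0|lia].
    - intros r Hr; destruct le_lt_dec; [lia|reflexivity].
    - intros r; destruct (le_lt_dec r n), (le_lt_dec (S r) n); try lia.
      + apply Hc.
      + split; [apply Hc|]; rewrite Hn by lia; exact Hyz.
      + split; [exact Hz|]; now apply linked_refl. }
  destruct (Vc (fun y => V y /\ reach y) (fun y => V y /\ ~ reach y)) as [H|H].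
  - intros y [Hy Hr]; destruct (Vo y Hy) as (r1 & Hr1 & H1).
    destruct (linked_near e y He) as (r2 & Hr2 & H2).
    exists (Rmin r1 r2); split; [now apply Rmin_pos|]; intros z Hz.
    assert (Vz : V z) by (apply H1; eapply Rlt_le_trans; [exact Hz|apply Rmin_l]).
    split; [exact Vz|]; apply (Hstep y); auto; apply H2; [rewrite drefl; exact Hr2|].
    eapply Rlt_le_trans; [exact Hz|apply Rmin_r].
  - intros y [Hy Hr]; destruct (Vo y Hy) as (r1 & Hr1 & H1).
    destruct (linked_near e y He) as (r2 & Hr2 & H2).
    exists (Rmin r1 r2); split; [now apply Rmin_pos|]; intros z Hz.
    assert (Vz : V z) by (apply H1; eapply Rlt_le_trans; [exact Hz|apply Rmin_l]).
    split; [exact Vz|]; intros Hz'; apply Hr; apply (Hstep z); auto.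
    apply H2; [|rewrite drefl; exact Hr2].
    eapply Rlt_le_trans; [exact Hz|apply Rmin_r].
  - intros x Hx; destruct (classic (reach x)); auto.
  - intros x (_ & [_ H1] & _ & H2); contradiction.
  - exact (proj2 (H q Hq)).
  - exfalso; apply (proj2 (H p Hp)); exists 0%nat, (fun _ => p); repeat split; auto.
    now apply linked_refl.
Qed.

(* A chain is an infinite sequence that is eventually constant, so that all the
   links of the chain [p] can be refined with the same number [N] of steps. *)
Lemma refine_chain (p : nat -> X) M y e e' : 0 < e' ->
  (forall i, (M <= i)%nat -> p i = y) -> (forall i, linked e (p i) (p (S i))) ->
  exists N p', (1 <= N)%nat /\ (forall i, (M * N <= i)%nat -> p' i = y) /\
    (forall i, linked e' (p' i) (p' (S i))) /\ p' 0%nat = p 0%nat /\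
    forall j, d (p (j / N)%nat) (p' j) < e.
Proof.
  intros He' HM Hp.
  assert (Hc : forall i, exists nc : nat * (nat -> X), snd nc 0%nat = p i /\
    (forall r, (fst nc <= r)%nat -> snd nc r = p (S i)) /\
    forall r, d (p i) (snd nc r) < e /\ linked e' (snd nc r) (snd nc (S r))).
  { intros i; destruct (Hp i) as (V & Vo & Vc & V1 & V2 & HV).
    destruct (chain_connected V e' (p i) (p (S i)) Vo Vc He' V1 V2) as (n & c & H1 & H2 & H3).
    exists (n, c); simpl; repeat split; auto; [apply HV; auto|]; apply H3. }
  apply choice in Hc as [nc Hc].
  set (c := fun i => snd (nc i)).
  destruct (list_bound (fun i => fst (nc i)) (seq 0 M)) as [K HK].
  (* [N] exceeds the number of steps needed by each of the first [M] links; shorter refinements are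
     padded by their constant tails. *)
  set (N := S K); exists N.
  assert (HcN : forall i, (i < M)%nat -> c i N = p (S i)).
  { intros i Hi; apply Hc; specialize (HK i); rewrite in_seq in HK; unfold N; lia. }
  assert (HcS : forall i r, S r = N -> linked e' (c i r) (c i N))
    by (intros i r <-; apply Hc).
  (* From index [M * N] on the value is set to [y], since the refinements of later links are not
     controlled by [N]. *)
  exists (fun j => if lt_dec (j / N) M then c (j / N)%nat (j mod N)%nat else y).
  assert (HN : (1 <= N)%nat) by (unfold N; lia).
  split; [exact HN|]; split; [|split; [|split]].
  - intros i Hi; destruct lt_dec as [Hl|]; [exfalso|reflexivity].
    pose proof (Nat.div_mod i N ltac:(lia)); pose proof (Nat.mod_upper_bound i N ltac:(lia)); nia.
  - intros j; destruct (div_mod_succ j N HN) as [(H1 & H2 & H3)|(H1 & H2 & H3)];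
      rewrite H2, H3; repeat destruct lt_dec; try lia.
    + apply Hc.
    + now apply linked_refl.
    + replace (c (S (j / N)) 0%nat) with (c (j / N)%nat N);
        [|rewrite HcN by assumption; symmetry; apply Hc].
      now apply HcS.
    + replace y with (c (j / N)%nat N) by (rewrite HcN by assumption; apply HM; lia).
      now apply HcS.
    + now apply linked_refl.
  - rewrite Nat.Div0.div_0_l, Nat.Div0.mod_0_l; destruct lt_dec; [apply Hc|].
    symmetry; apply HM; lia.
  - intros j; destruct lt_dec; [apply Hc|].
    rewrite HM by lia; destruct (Hp 0%nat) as (V & _ & _ & V1 & _ & HV).
    rewrite drefl, <- (drefl (p 0%nat)); auto.
Qed.

(** The path is the limit of finer and finer chains from [x] to [y]. At level [k] a parameter in the
    unit interval is sent to the entry indexed by the integer part of its product with [M k], and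
    each refinement moves that entry by less than e/2^k. The bound [3 * e] is e for the initial link
    plus 2e for the geometric series. *)
Lemma linked_path e x y : 0 < e -> linked e x y ->
  exists f, cpath d f /\ f 0 = x /\ f 1 = y /\ forall t, d x (f t) <= 3 * e.
Proof.
  intros He Hxy.
  set (ek := fun k => e * (1 / 2) ^ k).
  assert (Hek : forall k, 0 < ek k)
    by (intros k; apply Rmult_lt_0_compat; [lra|apply half_pow_pos]).
  destruct (dependent_choice
    (fun k (Mp : nat * (nat -> X)) => (1 <= fst Mp)%nat /\
       (forall i, (fst Mp <= i)%nat -> snd Mp i = y) /\
       (forall i, linked (ek k) (snd Mp i) (snd Mp (S i))) /\ snd Mp 0%nat = x)
    (fun k Mp Mp' => exists N, (1 <= N)%nat /\ fst Mp' = (fst Mp * N)%nat /\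
       forall j, d (snd Mp (j / N)%nat) (snd Mp' j) < ek k)
    (1%nat, fun i => match i with O => x | S _ => y end)) as (st & H0 & Hst).
  - simpl; repeat split; auto.
    + intros [|i] Hi; [lia|reflexivity].
    + unfold ek; simpl; rewrite Rmult_1_r; intros [|i]; [exact Hxy|now apply linked_refl].
  - intros k [M p] (HM1 & HM & Hp & Hp0); simpl in *.
    destruct (refine_chain p M y (ek k) (ek (S k)) (Hek _) HM Hp)
      as (N & p' & HN & H1 & H2 & H3 & H4).
    exists ((M * N)%nat, p'); simpl; repeat split; auto; [nia|congruence|].
    exists N; auto.
  - set (M := fun k => fst (st k)); set (p := fun k => snd (st k)).
    assert (HM1 : forall k, 1 <= INR (M k)).
    { intros k; change 1 with (INR 1); apply le_INR; apply (Hst k). }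
    assert (Hlim : forall t, exists z, forall k,
      d (p k (nfl (clamp t * INR (M k)))) z <= 2 * e * (1 / 2) ^ k).
    { intros t; apply geometric_limit; [exact He|]; intros k.
      destruct (Hst k) as (_ & N & HN & HMN & Hd).
      unfold M at 2; rewrite HMN, mult_INR, <- Rmult_assoc; fold (M k).
      rewrite (nfl_div (clamp t * INR (M k)) N); [|pose proof (clamp_bounds t);
        specialize (HM1 k); nra|exact HN].
      left; apply Hd. }
    apply choice in Hlim as [g Hg].
    assert (HMy : forall k i, (M k <= i)%nat -> p k i = y) by (intros k; apply (Hst k)).
    assert (Hg1 : g 1 = y).
    { symmetry; apply met_eq_of_small with (2 * e); intros k; specialize (Hg 1 k).
      rewrite clamp_id, Rmult_1_l in Hg by lra.
      rewrite (nfl_unique (INR (M k)) (M k)) in Hg by lra.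
      rewrite HMy in Hg by lia; exact Hg. }
    exists g; repeat split.
    (* The factor 5: twice the distance 2e/2^k to the limit, plus one link, because parameters
       closer than the inverse of [M k] have indices differing by at most one. *)
    + intros t eps Heps; destruct (half_pow_small (5 * e) eps) as [k Hk]; [lra|lra|].
      specialize (HM1 k).
      exists (/ INR (M k)); split; [apply Rinv_0_lt_compat; lra|]; intros t' Ht.
      pose proof (clamp_lip t t') as Hcl.
      pose proof (clamp_bounds t); pose proof (clamp_bounds t').
      assert (Hc : Rabs (clamp t' * INR (M k) - clamp t * INR (M k)) < 1).
      { rewrite <- Rmult_minus_distr_r, Rabs_mult, (Rabs_pos_eq (INR _)) by lra.
        apply Rlt_le_trans with (/ INR (M k) * INR (M k)); [|right; field; lra].
        apply Rmult_lt_compat_r; lra. }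
      destruct (nfl_spec (clamp t * INR (M k))) as [A1 A2]; [nra|].
      destruct (nfl_spec (clamp t' * INR (M k))) as [B1 B2]; [nra|].
      pose proof (Hg t k) as G1; pose proof (Hg t' k) as G2.
      set (i := nfl (clamp t * INR (M k))) in *; set (i' := nfl (clamp t' * INR (M k))) in *.
      assert (Hii : d (p k i') (p k i) < ek k).
      { apply Rabs_def2 in Hc.
        assert (C1 : INR i < INR (S (S i'))) by (rewrite !S_INR; lra).
        assert (C2 : INR i' < INR (S (S i))) by (rewrite !S_INR; lra).
        apply INR_lt in C1, C2.
        assert (Hl : forall j, d (p k j) (p k (S j)) < ek k).
        { intros j; destruct (Hst k) as ((_ & _ & Hl & _) & _).
          destruct (Hl j) as (V & _ & _ & V1 & V2 & HV); auto. }
        assert (i = i' \/ i = S i' \/ i' = S i) as [<-|[-> | ->]] by lia.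
        - rewrite drefl; apply Hek.
        - apply Hl.
        - rewrite dsym; apply Hl. }
      pose proof (dtri (g t') (p k i') (g t)) as T1; pose proof (dtri (p k i') (p k i) (g t)).
      rewrite (dsym (g t') (p k i')) in T1; unfold ek in Hii; lra.
    + symmetry; apply met_eq_of_small with (2 * e); intros k; specialize (Hg 0 k).
      rewrite clamp_id, Rmult_0_l in Hg by lra.
      rewrite (nfl_unique 0 0) in Hg by (simpl; lra).
      destruct (Hst k) as ((_ & _ & _ & Hx) & _); unfold p in Hg; rewrite Hx in Hg; exact Hg.
    + exact Hg1.
    + intros t; specialize (Hg t 0%nat); unfold p in Hg; rewrite H0 in Hg.
      simpl in Hg; rewrite Rmult_1_r in Hg.
      destruct Hxy as (V & _ & _ & V1 & V2 & HV); pose proof (HV x y V1 V2).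
      pose proof (dtri x y (g t)); destruct nfl; lra.
Qed.

Lemma uniformly_locally_path_connected e : 0 < e ->
  exists de, 0 < de /\ forall x y, d x y < de ->
    exists f, cpath d f /\ f 0 = x /\ f 1 = y /\ forall t, d x (f t) < e.
Proof.
  intros He.
  (* A quarter, since the path given by [linked_path] may stray up to three times the size of the
     link. *)
  assert (Hr : forall x, exists r, 0 < r /\ forall y z, d x y < r -> d x z < r ->
    linked (e / 4) y z) by (intros x; apply linked_near; lra).
  apply choice in Hr as [r Hr].
  destruct (lebesgue_number r) as (la & Hla & H); [intros x; apply Hr|].
  exists la; split; [exact Hla|]; intros x y Hxy; destruct (H x) as [z Hz].
  destruct (linked_path (e / 4) x y) as (f & Hf & H0 & H1 & H2); [lra| |].
  - apply (Hr z); apply Hz; [rewrite drefl; exact Hla|exact Hxy].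
  - exists f; repeat split; auto; intros t; specialize (H2 t); lra.
Qed.

End Topology.

(** * Finitely generated abelian groups *)

(** The group is treated as a subquotient of the integer-valued functions on [T]: representatives
    from a submodule [P], relations from a submodule [B]. *)
Record submodule {T : Type} (B : (T -> Z) -> Prop) : Prop := {
  sub_ext : forall phi psi, B phi -> (forall s, phi s = psi s) -> B psi;
  sub_zero : B (fun _ => 0%Z);
  sub_add : forall phi psi, B phi -> B psi -> B (fun s => (phi s + psi s)%Z);
  sub_scal : forall z phi, B phi -> B (fun s => (z * phi s)%Z) }.

Lemma sub_sub {T : Type} (B : (T -> Z) -> Prop) (HB : submodule B) phi psi :
  B phi -> B psi -> B (fun s => (phi s - psi s)%Z).
Proof.
  intros H1 H2; apply (sub_ext B HB (fun s => (phi s + -1 * psi s)%Z)).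
  - apply sub_add; [exact HB|exact H1|exact (sub_scal B HB (-1)%Z psi H2)].
  - intros; ring.
Qed.

Definition upd {A : Type} (G : nat -> A) (i : nat) (v : A) (j : nat) : A :=
  if Nat.eq_dec j i then v else G j.

Lemma upd_same {A : Type} (G : nat -> A) i v : upd G i v i = v.
Proof. unfold upd; destruct Nat.eq_dec; congruence. Qed.

Lemma upd_other {A : Type} (G : nat -> A) i j v : j <> i -> upd G i v j = G j.
Proof. unfold upd; destruct Nat.eq_dec; congruence. Qed.

Fixpoint comb {T : Type} (k : nat) (G : nat -> T -> Z) (a : nat -> Z) (s : T) : Z :=
  match k with
  | O => 0%Z
  | S k => (comb k G a s + a k * G k s)%Z
  end.

Section Combinations.
Context {T : Type}.
Implicit Types (G H : nat -> T -> Z) (a b : nat -> Z).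

Lemma comb_ext k G H a b s :
  (forall i, (i < k)%nat -> G i s = H i s /\ a i = b i) -> comb k G a s = comb k H b s.
Proof.
  induction k as [|k IH]; simpl; intros E; [reflexivity|].
  rewrite IH by auto; destruct (E k) as [-> ->]; [lia|reflexivity].
Qed.

Lemma comb_zero k G a s : (forall i, (i < k)%nat -> a i = 0%Z) -> comb k G a s = 0%Z.
Proof.
  induction k as [|k IH]; simpl; intros E; [reflexivity|].
  rewrite IH, (E k) by auto; ring.
Qed.

Lemma comb_add k G a b s :
  comb k G (fun i => (a i + b i)%Z) s = (comb k G a s + comb k G b s)%Z.
Proof. induction k as [|k IH]; simpl; [ring|rewrite IH; ring]. Qed.

Lemma comb_scal k G z a s : comb k G (fun i => (z * a i)%Z) s = (z * comb k G a s)%Z.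
Proof. induction k as [|k IH]; simpl; [ring|rewrite IH; ring]. Qed.

Lemma comb_upd_coef k G a i z s : (i < k)%nat ->
  comb k G (upd a i z) s = (comb k G a s + (z - a i) * G i s)%Z.
Proof.
  induction k as [|k IH]; simpl; intros Hi; [lia|].
  destruct (Nat.eq_dec i k) as [->|Hne].
  - rewrite upd_same, (comb_ext k G G (upd a k z) a); [ring|].
    intros j Hj; rewrite upd_other by lia; auto.
  - rewrite IH, upd_other by lia; ring.
Qed.

Lemma comb_upd_gen k G a i v s : (i < k)%nat ->
  comb k (upd G i v) a s = (comb k G a s + a i * (v s - G i s))%Z.
Proof.
  induction k as [|k IH]; simpl; intros Hi; [lia|].
  destruct (Nat.eq_dec i k) as [->|Hne].
  - rewrite upd_same, (comb_ext k (upd G k v) G a a); [ring|].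
    intros j Hj; rewrite upd_other by lia; auto.
  - rewrite IH, upd_other by lia; ring.
Qed.

Lemma comb_upd_last k G a v s : comb k (upd G k v) a s = comb k G a s.
Proof. apply comb_ext; intros i Hi; rewrite upd_other by lia; auto. Qed.

Lemma comb_upd_coef_last k G a z s : comb k G (upd a k z) s = comb k G a s.
Proof. apply comb_ext; intros i Hi; rewrite upd_other by lia; auto. Qed.

Lemma sub_comb (P : (T -> Z) -> Prop) k G a : submodule P ->
  (forall i, (i < k)%nat -> P (G i)) -> P (comb k G a).
Proof.
  intros HP; induction k as [|k IH]; intros HG; simpl; [apply sub_zero, HP|].
  apply sub_add; [exact HP|apply IH; auto|apply sub_scal; [exact HP|apply HG; lia]].
Qed.

Context (B P : (T -> Z) -> Prop) (HB : submodule B) (HP : submodule P).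

(** This inclusion is what a change of generators has to preserve: starting from a generating
    family, the new family generates as well. *)
Definition spans k G H :=
  forall a, exists b, B (fun s => (comb k G a s - comb k H b s)%Z).

Lemma spans_trans k G H K : spans k G H -> spans k H K -> spans k G K.
Proof.
  intros H1 H2 a; destruct (H1 a) as [b Hb], (H2 b) as [c Hc]; exists c.
  apply (sub_ext B HB _ _ (sub_add B HB _ _ Hb Hc)); intros; ring.
Qed.

Lemma spans_of_eq k G H :
  (forall a, exists b, forall s, comb k G a s = comb k H b s) -> spans k G H.
Proof.
  intros E a; destruct (E a) as [b Hb]; exists b.
  apply (sub_ext B HB _ _ (sub_zero B HB)); intros s; rewrite Hb; ring.
Qed.

Lemma spans_add_comb k G q : spans (S k) G
  (upd G k (fun s => (G k s + comb k G q s)%Z)).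
Proof.
  apply spans_of_eq; intros a.
  exists (upd (fun i => (a i - a k * q i)%Z) k (a k)); intros s; simpl.
  rewrite !upd_same, comb_upd_last, comb_upd_coef_last.
  rewrite (comb_ext k G G (fun i => (a i - a k * q i)%Z) (fun i => (a i + (- a k) * q i)%Z))
    by (intros; split; [reflexivity|ring]).
  rewrite comb_add, comb_scal; ring.
Qed.

Definition swap {A : Type} (G : nat -> A) i k := upd (upd G i (G k)) k (G i).

Lemma comb_swap k G a i s : (i < k)%nat ->
  comb (S k) (swap G i k) (swap a i k) s = comb (S k) G a s.
Proof.
  intros Hi; unfold swap; cbn [comb]; rewrite !upd_same, comb_upd_last, comb_upd_coef_last.
  rewrite comb_upd_gen, comb_upd_coef, upd_same by assumption; ring.
Qed.

Lemma spans_swap k G i : (i < k)%nat -> spans (S k) G (swap G i k).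
Proof.
  intros Hi; apply spans_of_eq; intros a; exists (swap a i k); intros s.
  now rewrite comb_swap.
Qed.

Lemma least_nat (Q : nat -> Prop) : (exists n, Q n) ->
  exists n, Q n /\ forall n', Q n' -> (n <= n')%nat.
Proof.
  intros [n Hn]; revert Hn; induction n as [n IH] using lt_wf_ind; intros Hn.
  destruct (classic (exists n', Q n' /\ (n' < n)%nat)) as [(n' & H1 & H2)|H].
  - exact (IH n' H2 H1).
  - exists n; split; [exact Hn|]; intros n' H'.
    destruct (le_lt_dec n n'); [assumption|exfalso; apply H; eauto].
Qed.

(* Among all the relations between all the generating families of the same size,
   choose one with a least positive coefficient [n]. Elementary changes of
   generators turn it into [n] times the last generator, and by minimality [n]
   divides the last coefficient of every other relation, so that the group splits. *)
Theorem cyclic_decomposition k G : (forall i, (i < k)%nat -> P (G i)) ->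
  exists (m : nat -> nat) H, (forall i, (i < k)%nat -> P (H i)) /\ spans k G H /\
    forall a, B (comb k H a) <-> forall i, (i < k)%nat -> Z.divide (Z.of_nat (m i)) (a i).
Proof.
  revert G; induction k as [|k IH]; intros G HG.
  { exists (fun _ => 0%nat), G; split; [intros; lia|]; split.
    - apply spans_of_eq; intros a; exists a; reflexivity.
    - intros a; split; [intros; lia|]; intros _; apply (sub_zero B HB). }
  set (gen := fun H => (forall i, (i < S k)%nat -> P (H i)) /\
    spans (S k) G H).
  assert (gen0 : gen G)
    by (split; [exact HG|apply spans_of_eq; intros a; exists a; reflexivity]).
  set (Q := fun n => (0 < n)%nat /\ exists H, gen H /\ exists a i,
    (i < S k)%nat /\ a i = Z.of_nat n /\ B (comb (S k) H a)).
  assert (HQ : forall H a i, gen H -> B (comb (S k) H a) ->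
    (i < S k)%nat -> (0 < a i)%Z -> Q (Z.to_nat (a i))).
  { intros H a i HH HBa Hi Hpos; split; [lia|].
    exists H; split; [exact HH|]; exists a, i; split; [exact Hi|].
    split; [rewrite Z2Nat.id; lia|exact HBa]. }
  destruct (classic (exists n, Q n)) as [HQn|HQn].
  - destruct (least_nat Q HQn) as (n & (Hn & H & HH & a & i & Hi & Hai & HBa) & Hmin).
    assert (Hmin' : forall H a i, gen H -> B (comb (S k) H a) ->
      (i < S k)%nat -> (0 <= a i < Z.of_nat n)%Z -> a i = 0%Z).
    { intros H' a' i' HH' HBa' Hi' Hr.
      destruct (Z.eq_dec (a' i') 0) as [E|E]; [exact E|exfalso].
      assert (Hq : Q (Z.to_nat (a' i'))) by (apply (HQ H'); auto; lia).
      apply Hmin in Hq; lia. }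
    assert (Hw : exists H a, gen H /\ a k = Z.of_nat n /\ B (comb (S k) H a)).
    { destruct (Nat.eq_dec i k) as [->|Hne]; [exists H, a; auto|].
      exists (swap H i k), (swap a i k); split; [split|split].
      - intros j Hj; unfold swap, upd; destruct HH as [HH _].
        repeat destruct Nat.eq_dec; apply HH; lia.
      - apply (spans_trans _ _ H); [apply HH|apply spans_swap; lia].
      - unfold swap; rewrite upd_same; exact Hai.
      - apply (sub_ext B HB _ _ HBa); intros s; rewrite comb_swap by lia; reflexivity. }
    clear H HH a i Hi Hai HBa; destruct Hw as (H & a & HH & Hak & HBa).
    assert (Hadd : forall q, gen (upd H k (fun s => (H k s + comb k H q s)%Z))).
    { intros q; split.
      - intros j Hj; unfold upd; destruct Nat.eq_dec; [|now apply HH].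
        apply sub_add; [exact HP|apply HH; lia|].
        apply sub_comb; [exact HP|intros; apply HH; lia].
      - apply (spans_trans _ _ H); [apply HH|apply spans_add_comb]. }
    (* Adding q times generator [i] to the last generator turns the coefficient [a i] into its
       remainder modulo [n], which vanishes by minimality. *)
    assert (Hdiv : forall i, (i < k)%nat -> (a i = Z.of_nat n * (a i / Z.of_nat n))%Z).
    { intros i Hi; pose proof (Z.div_mod (a i) (Z.of_nat n) ltac:(lia)) as E.
      pose proof (Z.mod_pos_bound (a i) (Z.of_nat n) ltac:(lia)) as Hr.
      set (q := (a i / Z.of_nat n)%Z) in *; set (r := (a i mod Z.of_nat n)%Z) in *.
      pose proof (Hmin' _ (upd a i r) i (Hadd (upd (fun _ => 0%Z) i q))) as Hm.
      rewrite upd_same in Hm; rewrite Hm in E; [lia| |lia|exact Hr].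
      apply (sub_ext B HB _ _ HBa); intros s; cbn [comb].
      rewrite upd_same, comb_upd_last, !comb_upd_coef by assumption.
      rewrite upd_other by lia; rewrite (comb_zero k H (fun _ => 0%Z)) by auto.
      replace r with (a i - Z.of_nat n * q)%Z by lia; rewrite Hak; ring. }
    set (H2 := upd H k (fun s => (H k s + comb k H (fun i => (a i / Z.of_nat n)%Z) s)%Z)).
    assert (HH2 : gen H2) by apply Hadd.
    assert (Hrel : B (fun s => (Z.of_nat n * H2 k s)%Z)).
    { apply (sub_ext B HB _ _ HBa); intros s; unfold H2; rewrite upd_same; cbn [comb].
      rewrite Z.mul_add_distr_l, <- comb_scal, Hak, Z.add_comm; f_equal.
      apply comb_ext; intros i Hi; split; [reflexivity|now apply Hdiv]. }
    destruct (IH H2) as (m & H3 & HP3 & Hs3 & Hm3); [intros; apply HH2; lia|].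
    (* The induction hypothesis decomposes the first [k] generators; the last one splits off as a
       cyclic summand of order [n]. *)
    set (F := upd H3 k (H2 k)).
    assert (HF : gen F).
    { split.
      - intros j Hj; unfold F, upd; destruct Nat.eq_dec; [apply HH2; lia|apply HP3; lia].
      - apply (spans_trans _ _ H2); [apply HH2|]; intros b; destruct (Hs3 b) as [c Hc].
        exists (upd c k (b k)); apply (sub_ext B HB _ _ Hc); intros s; cbn [comb].
        unfold F; rewrite !upd_same, comb_upd_last, comb_upd_coef_last; ring. }
    exists (upd m k n), F; split; [apply HF|]; split; [apply HF|]; intros b.
    assert (HFk : forall s, F k s = H2 k s) by (intros; unfold F; now rewrite upd_same).
    assert (HFb : forall s, comb k F b s = comb k H3 b s)
      by (intros; unfold F; apply comb_upd_last).
    split.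
    + intros HBb.
      (* Subtracting a multiple of the relation [Hrel] leaves the remainder of [b k], again zero by
         minimality. *)
      assert (Hbk : (b k = Z.of_nat n * (b k / Z.of_nat n))%Z).
      { pose proof (Z.div_mod (b k) (Z.of_nat n) ltac:(lia)) as E.
        pose proof (Z.mod_pos_bound (b k) (Z.of_nat n) ltac:(lia)) as Hr.
        set (q := (b k / Z.of_nat n)%Z) in *; set (r := (b k mod Z.of_nat n)%Z) in *.
        pose proof (Hmin' F (upd b k r) k HF) as Hm; rewrite upd_same in Hm.
        rewrite Hm in E; [lia| |lia|exact Hr].
        apply (sub_ext B HB _ _ (sub_sub B HB _ _ HBb (sub_scal B HB q _ Hrel))).
        intros s; rewrite comb_upd_coef, HFk by lia; rewrite E; ring. }
      assert (HBk : B (comb k H3 b)).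
      { apply (sub_ext B HB _ _ (sub_sub B HB _ _ HBb
          (sub_scal B HB (b k / Z.of_nat n)%Z _ Hrel))).
        intros s; cbn [comb]; rewrite HFb, HFk; rewrite Hbk at 1; ring. }
      intros i Hi; destruct (Nat.eq_dec i k) as [->|Hne].
      * rewrite upd_same; exists (b k / Z.of_nat n)%Z; lia.
      * rewrite upd_other by assumption; apply Hm3; [exact HBk|lia].
    + intros Hb; destruct (Hb k) as [q Hq]; [lia|]; rewrite upd_same in Hq.
      assert (HBk : B (comb k H3 b)).
      { apply Hm3; intros i Hi; specialize (Hb i); rewrite upd_other in Hb by lia.
        apply Hb; lia. }
      apply (sub_ext B HB _ _ (sub_add B HB _ _ HBk (sub_scal B HB q _ Hrel))).
      intros s; cbn [comb]; rewrite HFb, HFk, Hq; ring.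
  (* No relation has a positive coefficient and, by negation, none has a negative one: the group is
     free on [G], which the orders 0 express. *)
  - exists (fun _ => 0%nat), G; split; [exact HG|]; split; [apply gen0|]; intros a; split.
    + intros HBa i Hi; exists 0%Z.
      destruct (Z.lt_trichotomy (a i) 0) as [Hl|[Hl|Hl]]; [exfalso|lia|exfalso];
        apply HQn; eexists.
      * apply (HQ G (fun i => (-1 * a i)%Z) i gen0); [|exact Hi|lia].
        apply (sub_ext B HB _ _ (sub_scal B HB (-1)%Z _ HBa)).
        intros s; rewrite comb_scal; reflexivity.
      * apply (HQ G a i gen0); [exact HBa|exact Hi|lia].
    + intros Ha; apply (sub_ext B HB _ _ (sub_zero B HB)).
      intros s; rewrite comb_zero; [reflexivity|].
      intros i Hi; destruct (Ha i Hi) as [q Hq]; simpl in Hq; lia.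
Qed.

End Combinations.

(** * The finitely generated case *)

Lemma lincomb_coef {X : Type} k (g : nat -> chain1 X) a s :
  coef (lincomb k g a) s = comb k (fun i => coef (g i)) a s.
Proof.
  unfold lincomb; induction k as [|k IH]; [reflexivity|].
  rewrite seq_S, flat_map_app, coef_app, IH; cbn [flat_map comb]; rewrite app_nil_r.
  f_equal; exact (coef_scale (a k) (g k) s).
Qed.

Section FinitelyGenerated.
Context {X : Type} (d : X -> X -> R) (hmet : is_metric d).
Local Notation drefl := (met_refl d hmet).
Local Notation dsym := (met_sym d hmet).
Local Notation dtri := (met_tri d hmet).

Lemma submodule_Bd : submodule (Bd d).
Proof.
  constructor; [apply Bd_ext|apply Bd_zero|apply Bd_add|apply Bd_scal].
Qed.

Definition cycle_class (phi : (stdI -> X) -> Z) : Prop :=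
  exists c, is_cycle1 d c /\ forall s, coef c s = phi s.

Lemma submodule_cycle_class : submodule cycle_class.
Proof.
  constructor.
  - intros phi psi (c & Hc & H) E; exists c; split; [exact Hc|].
    intros; now rewrite H, E.
  - exists nil; repeat split; intros p [].
  - intros phi psi (c & [Hc Hb] & H) (c' & [Hc' Hb'] & H'); exists (c ++ c'); split; [split|].
    + intros p Hp; apply in_app_or in Hp as [Hp|Hp]; auto.
    + intros x; unfold bd1; rewrite flat_map_app, coef_app.
      unfold bd1 in Hb, Hb'; rewrite Hb, Hb'; reflexivity.
    + intros; now rewrite coef_app, H, H'.
  - intros z phi (c & [Hc Hb] & H); exists (scale z c); split; [split|].
    + intros p Hp; apply in_map_iff in Hp as (q & <- & Hq); exact (Hc q Hq).
    + intros x; transitivity (z * coef (bd1 c) x)%Z; [|rewrite Hb; ring].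
      clear Hc Hb H; induction c as [|[w s] c IH]; [unfold coef; simpl; ring|].
      change (coef (bd1 (scale z ((w, s) :: c))) x) with
        (coef (((z * w)%Z, s I1) :: ((- (z * w))%Z, s I0) :: bd1 (scale z c)) x).
      change (bd1 ((w, s) :: c)) with ((w, s I1) :: ((- w)%Z, s I0) :: bd1 c).
      rewrite !coef_cons, IH; ring.
    + intros; now rewrite coef_scale, H.
Qed.

Definition small_loops_bound : Prop := forall x, exists e, 0 < e /\
  forall f, cpath d f -> f 0 = x -> f 1 = x -> (forall t, d x (f t) < e) ->
  Bd d (ind (seg f 0 1)).

(** * Path components and their representatives *)

Definition pathconn (x y : X) : Prop := exists phi, chain_path d (fun _ => True) x y phi.

Lemma pathconn_of_path (f : R -> X) : cpath d f -> pathconn (f 0) (f 1).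
Proof. intros Hf; eexists; apply chain_path_seg; auto. Qed.

(** Points of one path component must get equal representatives for the generating loops to close
    up. Apart from a proof of inhabitedness, the choice depends on [x] only through the predicate
    [pathconn x], which is the same throughout the component. *)
Definition root (x : X) : X := epsilon (inhabits x) (pathconn x).

Lemma root_pathconn x : pathconn x (root x).
Proof.
  unfold root; apply epsilon_spec; exists x, (ind (seg (fun _ => x) 0 0)).
  apply (chain_path_seg d (fun _ => True) (fun _ => x) 0 0); auto.
  now apply cpath_const.
Qed.

Lemma root_eq x y : pathconn x y -> root x = root y.
Proof.
  intros [phi Hxy]; unfold root.
  replace (pathconn x) with (pathconn y).
  - f_equal; apply proof_irrelevance.
  - apply functional_extensionality; intros z; apply propositional_extensionality.
    split; intros [psi H]; eexists.
    + exact (chain_path_concat d hmet _ _ _ _ _ _ Hxy H).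
    + exact (chain_path_concat d hmet _ _ _ _ _ _ (chain_path_rev d _ _ _ _ Hxy) H).
Qed.

Lemma path_from_root x : exists f, cpath d f /\ f 0 = root x /\ f 1 = x.
Proof.
  destruct (root_pathconn x) as [phi H]; apply chain_path_rev in H.
  destruct H as (f & Hf & H0 & H1 & _); exists f; auto.
Qed.

Lemma uniformly_continuous (f : R -> X) eps : cpath d f -> 0 < eps ->
  exists n, (0 < n)%nat /\ forall a b, 0 <= a <= 1 -> Rabs (b - a) <= / INR n ->
    d (f a) (f b) < eps.
Proof.
  intros Hf He.
  assert (Hd : forall t, exists de : posreal, forall t', Rabs (t' - t) < 2 * de ->
    d (f t') (f t) < eps / 2).
  { intros t; destruct (Hf t (eps / 2)) as (de & Hde & H); [lra|].
    assert (Hde2 : 0 < de / 2) by lra.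
    exists (mkposreal (de / 2) Hde2); simpl; intros t' Ht; apply H; lra. }
  apply choice in Hd as [de Hde].
  destruct (compactness_value_1d 0 1 de) as [d0 Hd0].
  destruct (archimed_cor1 d0 (cond_pos d0)) as (n & Hn & Hn0).
  exists n; split; [exact Hn0|]; intros a b Ha Hab.
  (* [compactness_value_1d] yields its point t only under a double negation, hence the argument by
     contradiction. *)
  apply NNPP; intros Hno; apply (Hd0 a Ha); intros (t & Ht & Hat & Hd0t); apply Hno.
  pose proof (cond_pos (de t)) as Hp.
  pose proof (Hde t a ltac:(lra)) as H1.
  assert (H2 : d (f b) (f t) < eps / 2).
  { apply Hde; replace (b - t) with ((b - a) + (a - t)) by ring.
    apply Rle_lt_trans with (1 := Rabs_triang _ _); lra. }
  pose proof (dtri (f a) (f t) (f b)); rewrite (dsym (f t)) in H; lra.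
Qed.

Context (hcpt : metric_compact d) (hlc : locally_connected d).

(** A closed chain near [x] but based at [u] is conjugated by a path from [x] to [u], whose two
    copies cancel as chains. In the Lebesgue number, [r] makes this path available and [e] keeps the
    loop small. *)
Lemma small_cycles_bound : small_loops_bound ->
  exists la, 0 < la /\ forall y u phi,
    chain_path d (fun z => d y z < la) u u phi -> Bd d phi.
Proof.
  intros Hs; apply choice in Hs as [e He].
  assert (Hr : forall x, exists r, 0 < r /\ forall y, d x y < r ->
    exists f, cpath d f /\ f 0 = x /\ f 1 = y /\ forall t, d x (f t) < e x).
  { intros x; destruct (uniformly_locally_path_connected d hmet hcpt hlc (e x))
      as (r & Hr & H); [apply He|]; exists r; auto. }
  apply choice in Hr as [r Hr].
  destruct (lebesgue_number d hmet hcpt (fun x => Rmin (r x) (e x))) as (la & Hla & HL).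
  { intros x; apply Rmin_pos; [apply Hr|apply He]. }
  exists la; split; [exact Hla|]; intros y u phi Hphi.
  destruct (HL y) as [x Hx].
  assert (Hu : d x u < r x).
  { destruct Hphi as (f & _ & H0 & _ & HS & _); specialize (HS 0); rewrite H0 in HS.
    eapply Rlt_le_trans; [exact (Hx u HS)|apply Rmin_l]. }
  destruct (proj2 (Hr x) u Hu) as (c & Hc & Hc0 & Hc1 & Hcx).
  apply (chain_path_mono d _ (fun z => d x z < e x)) in Hphi.
  2: { intros z Hz; eapply Rlt_le_trans; [exact (Hx z Hz)|apply Rmin_r]. }
  pose proof (chain_path_seg d (fun z => d x z < e x) c 0 1 Hc
    (fun t _ => Hcx _)) as HcP; rewrite Hc0, Hc1 in HcP.
  destruct (chain_path_concat d hmet _ _ _ _ _ _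
    (chain_path_concat d hmet _ _ _ _ _ _ HcP Hphi) (chain_path_rev d _ _ _ _ HcP))
    as (f & Hf & H0 & H1 & HS & HB).
  apply (Bd_ext d _ _ (Bd_sub d _ _ (proj2 (He x) f Hf H0 H1 HS) HB)); intros; ring.
Qed.

(* Relative to a finite net, [P w] joins the root of the component of [w] to [w],
   and [G] lists the loops made of an edge of the net and two paths to the root. *)
Lemma cycles_finitely_generated (x0 : X) : small_loops_bound ->
  exists K (G : nat -> (stdI -> X) -> Z) (P : X -> (stdI -> X) -> Z),
    (forall k, cycle_class (G k)) /\
    exists eps, 0 < eps /\ forall f a b, cpath d f ->
      (forall t, 0 <= t <= 1 -> d (f a) (f (a + t * (b - a))) < eps) ->
      exists k, (k < K)%nat /\
        Bd d (fun s => (ind (seg f a b) s + P (f a) s - P (f b) s - G k s)%Z).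
Proof.
  intros Hs; destruct (small_cycles_bound Hs) as (la & Hla & HB).
  (* The four sides of the quadrilateral formed below stay within [2 * e] of its vertex [V], well
     inside the radius [la]. *)
  set (e := la / 8); assert (He : 0 < e) by (unfold e; lra).
  destruct (uniformly_locally_path_connected d hmet hcpt hlc e He) as (de & Hde & Hpath).
  set (eta := Rmin de e).
  assert (Heta : 0 < eta) by (apply Rmin_pos; assumption).
  assert (Heta1 : eta <= de) by apply Rmin_l.
  assert (Heta2 : eta <= e) by apply Rmin_r.
  destruct (compact_cover d hmet hcpt (fun _ => eta / 3)) as [l Hl]; [intros; lra|].
  assert (Hv : forall x, exists y, In y l /\ d y x < eta / 3) by exact Hl.
  apply choice in Hv as [v Hv].
  assert (Hp : forall w, exists f, cpath d f /\ f 0 = v w /\ f 1 = w /\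
    forall t, d (v w) (f t) < e).
  { intros w; apply Hpath; specialize (Hv w); lra. }
  apply choice in Hp as [p Hp].
  assert (HE : forall vv : X * X, exists f, d (fst vv) (snd vv) < de ->
    cpath d f /\ f 0 = fst vv /\ f 1 = snd vv /\ forall t, d (fst vv) (f t) < e).
  { intros [y z]; simpl; destruct (Rlt_dec (d y z) de) as [H|H].
    - destruct (Hpath y z H) as [f Hf]; exists f; auto.
    - exists (fun _ => y); intros; contradiction. }
  apply choice in HE as [E HE].
  destruct (choice _ path_from_root) as [q Hq].
  (* Every index has to give a cycle: pairs too far apart get the empty chain, and indices out of
     range a default pair. *)
  set (G := fun k => coef (let vv := nth k (list_prod l l) (x0, x0) in
    if Rlt_dec (d (fst vv) (snd vv)) de then
      [(1%Z, seg (q (fst vv)) 0 1); (1%Z, seg (E vv) 0 1); ((-1)%Z, seg (q (snd vv)) 0 1)]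
    else [])).
  exists (length (list_prod l l)), G,
    (fun w s => (ind (seg (q (v w)) 0 1) s + ind (seg (p w) 0 1) s)%Z).
  assert (Hseg0 : forall f : R -> X, seg f 0 1 I0 = f 0)
    by (intros f; unfold seg; f_equal; simpl; ring).
  assert (Hseg1 : forall f : R -> X, seg f 0 1 I1 = f 1)
    by (intros f; unfold seg; f_equal; simpl; ring).
  split.
  - intros k; unfold G; eexists; split; [|intros; reflexivity].
    set (vv := nth k (list_prod l l) (x0, x0)); cbv zeta.
    destruct Rlt_dec as [Hlt|]; [|split; [intros ? []|reflexivity]].
    destruct (HE vv Hlt) as (HE1 & HE2 & HE3 & _).
    assert (Hroot : root (fst vv) = root (snd vv)).
    { apply root_eq; rewrite <- HE2, <- HE3; now apply pathconn_of_path. }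
    split.
    + intros ? [<-|[<-|[<-|[]]]]; simpl; apply cont1_seg; auto; apply Hq.
    + intros x; unfold bd1; cbn [flat_map app fst snd]; rewrite !Hseg0, !Hseg1.
      destruct (Hq (fst vv)) as (_ & -> & ->), (Hq (snd vv)) as (_ & -> & ->).
      rewrite HE2, HE3, Hroot, !coef_cons, coef_nil; ring.
  - exists (eta / 3); split; [lra|]; intros f a b Hf Hab.
    set (V := v (f a)); set (V' := v (f b)).
    destruct (Hv (f a)) as [HV1 HV2], (Hv (f b)) as [HV1' HV2']; fold V in HV1, HV2;
      fold V' in HV1', HV2'.
    assert (Hfab : d (f a) (f b) < eta / 3).
    { specialize (Hab 1); replace (a + 1 * (b - a)) with b in Hab by ring; apply Hab; lra. }
    assert (HVV : d V V' < eta).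
    { pose proof (dtri V (f a) V'); pose proof (dtri (f a) (f b) V') as H'.
      rewrite (dsym (f b) V') in H'; lra. }
    destruct (In_nth (list_prod l l) (V, V') (x0, x0)) as (k & Hk & HkV);
      [now apply in_prod|].
    exists k; split; [exact Hk|].
    destruct (HE (V, V')) as (HE1 & HE2 & HE3 & HE4); [simpl; lra|]; simpl in HE2, HE3, HE4.
    destruct (Hp (f a)) as (Ha1 & Ha2 & Ha3 & Ha4), (Hp (f b)) as (Hb1 & Hb2 & Hb3 & Hb4).
    fold V in Ha2, Ha4; fold V' in Hb2, Hb4.
    set (S := fun z => d V z < la).
    assert (C1 : chain_path d S V (f a) (ind (seg (p (f a)) 0 1))).
    { pose proof (chain_path_seg d S (p (f a)) 0 1 Ha1) as C.
      rewrite Ha2, Ha3 in C; apply C; intros t _; unfold S.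
      specialize (Ha4 (0 + t * (1 - 0))); unfold e in *; lra. }
    assert (C2 : chain_path d S (f a) (f b) (ind (seg f a b))).
    { apply chain_path_seg; [exact Hf|]; intros t Ht; unfold S.
      specialize (Hab t Ht); pose proof (dtri V (f a) (f (a + t * (b - a)))).
      unfold e in *; lra. }
    assert (C3 : chain_path d S V' (f b) (ind (seg (p (f b)) 0 1))).
    { pose proof (chain_path_seg d S (p (f b)) 0 1 Hb1) as C.
      rewrite Hb2, Hb3 in C; apply C; intros t _; unfold S.
      specialize (Hb4 (0 + t * (1 - 0))).
      pose proof (dtri V V' (p (f b) (0 + t * (1 - 0)))); unfold e in *; lra. }
    assert (C4 : chain_path d S V V' (ind (seg (E (V, V')) 0 1))).
    { pose proof (chain_path_seg d S (E (V, V')) 0 1 HE1) as C.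
      rewrite HE2, HE3 in C; apply C; intros t _; unfold S.
      specialize (HE4 (0 + t * (1 - 0))); unfold e in *; lra. }
    apply (chain_path_rev d) in C3, C4.
    (* The sides from [V] through [f a], [f b] and [V'] back to [V] form a closed chain in a small
       ball; the paths to the roots occurring in [P] and [G k] cancel. *)
    pose proof (HB V V _ (chain_path_concat d hmet _ _ _ _ _ _
      (chain_path_concat d hmet _ _ _ _ _ _
        (chain_path_concat d hmet _ _ _ _ _ _ C1 C2) C3) C4)) as HBd.
    apply (Bd_ext d _ _ HBd); intros s; unfold G; cbv zeta; rewrite HkV; cbn [fst snd].
    destruct Rlt_dec as [_|Hn]; [|exfalso; lra].
    rewrite !coef_cons, coef_nil; fold V V'; ring.
Qed.

(** The simplex is cut into [n] short pieces, each of them a generator up to the terms in [P]; these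
    telescope, so that only its ends contribute. *)
Lemma simplex_decomposition K (G : nat -> (stdI -> X) -> Z) (P : X -> (stdI -> X) -> Z) eps :
  0 < eps ->
  (forall f a b, cpath d f ->
    (forall t, 0 <= t <= 1 -> d (f a) (f (a + t * (b - a))) < eps) ->
    exists k, (k < K)%nat /\
      Bd d (fun s => (ind (seg f a b) s + P (f a) s - P (f b) s - G k s)%Z)) ->
  forall s0, cont1 d s0 -> exists a : nat -> Z,
    Bd d (fun s => (ind s0 s - (P (s0 I1) s - P (s0 I0) s) - comb K G a s)%Z).
Proof.
  intros He HG s0 Hs0.
  set (f := fun t => s0 (toI t)).
  assert (Hf : cpath d f) by now apply cpath_toI.
  destruct (uniformly_continuous f eps Hf He) as (n & Hn & Hu).
  assert (Hn' : 0 < INR n) by now apply lt_0_INR.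
  assert (Hr : forall r, (r <= n)%nat -> exists a : nat -> Z,
    Bd d (fun s => (ind (seg f 0 (INR r / INR n)) s + P (f 0%R) s
                    - P (f (INR r / INR n)%R) s - comb K G a s)%Z)).
  { induction r as [|r IH]; intros Hrn.
    - exists (fun _ => 0%Z); simpl INR; unfold Rdiv; rewrite Rmult_0_l.
      apply (Bd_ext d _ _ (Bd_seg_same d f 0 Hf)); intros s.
      rewrite (comb_zero K G (fun _ => 0%Z)) by auto; ring.
    - destruct IH as [a Ha]; [lia|].
      assert (Hr1 : INR (S r) <= INR n) by now apply le_INR.
      rewrite S_INR in *; pose proof (pos_INR r).
      destruct (HG f (INR r / INR n) ((INR r + 1) / INR n) Hf) as (k & Hk & Hkb).
      { intros t Ht; apply Hu.
        - split; [apply Rdiv_le_0_compat; lra|].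
          apply Rmult_le_reg_r with (INR n); [lra|]; unfold Rdiv.
          rewrite Rmult_assoc, Rinv_l by lra; lra.
        - replace (_ - _) with (t * / INR n) by (field; lra).
          assert (0 < / INR n) by (apply Rinv_0_lt_compat; lra).
          rewrite Rabs_pos_eq by nra; nra. }
      exists (upd a k (a k + 1)%Z).
      apply (Bd_ext d _ _ (Bd_sub d _ _ (Bd_add d _ _ Ha Hkb)
        (Bd_triangle d f 0 (INR r / INR n) ((INR r + 1) / INR n) Hf))).
      intros s; rewrite comb_upd_coef by exact Hk; ring. }
  destruct (Hr n (Nat.le_refl n)) as [a Ha]; exists a.
  apply (Bd_ext d _ _ Ha); intros s; unfold Rdiv; rewrite Rinv_r by lra.
  unfold f at 1; rewrite seg_toI; unfold f; rewrite toI_0, toI_1; ring.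
Qed.

(** The corrections [P] add up to their linear extension evaluated on [bd1 c]; for a cycle this sum
    vanishes by [zsum_coef_zero]. *)
Lemma chain_decomposition K (G : nat -> (stdI -> X) -> Z) (P : X -> (stdI -> X) -> Z) :
  (forall s0, cont1 d s0 -> exists a : nat -> Z,
    Bd d (fun s => (ind s0 s - (P (s0 I1) s - P (s0 I0) s) - comb K G a s)%Z)) ->
  forall c, is_chain1 d c -> exists a : nat -> Z,
    Bd d (fun s => (coef c s - zsum (fun p => (fst p * P (snd p) s)%Z) (bd1 c)
                    - comb K G a s)%Z).
Proof.
  intros HG; induction c as [|[z s0] c IH]; intros Hc.
  - exists (fun _ => 0%Z); apply (Bd_ext d _ _ (Bd_zero d)); intros s.
    rewrite (comb_zero K G (fun _ => 0%Z)) by auto; reflexivity.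
  - destruct IH as [a Ha]; [intros p Hp; apply Hc; now right|].
    destruct (HG s0) as [b Hb]; [apply (Hc (z, s0)); now left|].
    exists (fun i => (z * b i + a i)%Z).
    apply (Bd_ext d _ _ (Bd_add d _ _ (Bd_scal d z _ Hb) Ha)); intros s.
    change (bd1 ((z, s0) :: c)) with ((z, s0 I1) :: ((- z)%Z, s0 I0) :: bd1 c).
    rewrite coef_cons, !zsum_cons, comb_add, comb_scal; cbn [fst snd]; ring.
Qed.

Theorem finite_sum_of_cyclic : small_loops_bound -> H1_finite_sum_of_cyclic d.
Proof.
  intros Hs; destruct (classic (inhabited X)) as [[x0]|Hempty].
  2: { exists 0%nat, (fun _ => 0%nat), (fun _ => nil); split; [intros; lia|]; split.
    - intros [|[z s] c] _; [|exfalso; apply Hempty; exact (inhabits (s I0))].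
      exists (fun _ => 0%Z), nil; split; [intros p []|reflexivity].
    - intros a; split; [intros; lia|]; intros _.
      exists nil; split; [intros p []|reflexivity]. }
  destruct (cycles_finitely_generated x0 Hs) as (K & G & P & HG & eps & He & Hpiece).
  destruct (cyclic_decomposition (Bd d) cycle_class submodule_Bd submodule_cycle_class
    K G (fun i _ => HG i)) as (m & H & HH & Hspan & Hm).
  assert (Hg : forall i, exists c, (i < K)%nat ->
    is_cycle1 d c /\ forall s, coef c s = H i s).
  { intros i; destruct (classic (i < K)%nat) as [Hi|Hi].
    - destruct (HH i Hi) as [c Hc]; exists c; auto.
    - exists nil; intros; contradiction. }
  apply choice in Hg as [g Hg].
  assert (Hcomb : forall a s, coef (lincomb K g a) s = comb K H a s).
  { intros a s; rewrite lincomb_coef; apply comb_ext; intros i Hi.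
    split; [now apply Hg|reflexivity]. }
  exists K, m, g; split; [intros i Hi; now apply Hg|]; split.
  - intros c [Hc Hbc].
    destruct (chain_decomposition K G P
      (simplex_decomposition K G P eps He Hpiece) c Hc) as [a Ha].
    destruct (Hspan a) as [b Hb]; exists b.
    apply (Bd_ext d _ _ (Bd_add d _ _ Ha Hb)); intros s; rewrite Hcomb.
    rewrite (zsum_coef_zero (fun x => P x s) (bd1 c) Hbc); ring.
  - intros a; rewrite <- Hm; split; intros HB; apply (Bd_ext d _ _ HB); intros s;
      rewrite Hcomb, coef_nil; ring.
Qed.

End FinitelyGenerated.

(** * Baire category in the Cantor space *)

(** [agree n al] is the basic cylinder of length [n] around [al]. *)
Definition agree (n : nat) (al be : nat -> bool) : Prop :=
  forall i, (i < n)%nat -> al i = be i.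

Definition nowhere_dense (E : (nat -> bool) -> Prop) : Prop :=
  forall al n, exists be m, (n <= m)%nat /\ agree n al be /\
    forall ga, agree m be ga -> ~ E ga.

Definition meager (A : (nat -> bool) -> Prop) : Prop :=
  exists E : nat -> (nat -> bool) -> Prop,
    (forall k, nowhere_dense (E k)) /\ forall al, A al -> exists k, E k al.

Lemma agree_trans n al be ga : agree n al be -> agree n be ga -> agree n al ga.
Proof. intros H1 H2 i Hi; rewrite H1, H2; auto. Qed.

Lemma agree_le m n al be : (m <= n)%nat -> agree n al be -> agree m al be.
Proof. intros Hmn H i Hi; apply H; lia. Qed.

Lemma meager_sub (A A' : (nat -> bool) -> Prop) :
  (forall al, A' al -> A al) -> meager A -> meager A'.
Proof. intros H (E & HE & HA); exists E; split; auto. Qed.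

Lemma meager_union (A : nat -> (nat -> bool) -> Prop) :
  (forall k, meager (A k)) -> meager (fun al => exists k, A k al).
Proof.
  intros H; apply choice in H as [E HE].
  exists (fun n => E (fst (of_nat n)) (snd (of_nat n))); split.
  - intros k; apply HE.
  - intros al [k Hk]; apply HE in Hk as [j Hj]; exists (to_nat (k, j)).
    rewrite cancel_of_to; exact Hj.
Qed.

Lemma meager_nowhere_dense E : nowhere_dense E -> meager E.
Proof. intros HE; exists (fun _ => E); split; [auto|]; intros al H; now exists 0%nat. Qed.

Lemma meager_or (A A' : (nat -> bool) -> Prop) :
  meager A -> meager A' -> meager (fun al => A al \/ A' al).
Proof.
  intros H H'; apply meager_sub with (fun al => exists k : nat,
    (match k with O => A | _ => A' end) al).
  - intros al [Ha|Ha]; [now exists 0%nat|now exists 1%nat].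
  - apply meager_union; intros [|k]; assumption.
Qed.

(** The Baire category theorem for the Cantor space. *)
Lemma not_meager_cylinder al n : ~ meager (agree n al).
Proof.
  intros (E & HE & HA).
  destruct (dependent_choice (fun k (s : (nat -> bool) * nat) => (k <= snd s)%nat)
    (fun k s s' => (snd s <= snd s')%nat /\ agree (snd s) (fst s) (fst s') /\
       forall ga, agree (snd s') (fst s') ga -> ~ E k ga) (al, n)) as (u & H0 & Hu).
  - simpl; lia.
  - intros k [be m] Hm; simpl in *.
    destruct (HE k be m) as (be' & m' & H1 & H2 & H3).
    exists (be', Nat.max m' (S k)); simpl; repeat split; [lia|lia|exact H2|].
    intros ga Hga; apply H3; revert Hga; apply agree_le; lia.
  (* Stage [k] fixes at least the first [k] coordinates, so coordinate [i] is settled only at stage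
     [S i]. *)
  - set (de := fun i => fst (u (S i)) i).
    assert (Hmono : forall k j, (snd (u k) <= snd (u (k + j)%nat))%nat /\
      agree (snd (u k)) (fst (u k)) (fst (u (k + j)%nat))).
    { intros k j; induction j as [|j [IH1 IH2]].
      - rewrite Nat.add_0_r; split; [lia|]; intros i _; reflexivity.
      - rewrite Nat.add_succ_r; destruct (Hu (k + j)%nat) as (_ & H1 & H2 & _).
        split; [lia|]; apply (agree_trans _ _ _ _ IH2); revert H2; apply agree_le; exact IH1. }
    assert (Hde : forall k, agree (snd (u k)) (fst (u k)) de).
    { intros k i Hi; unfold de.
      destruct (le_lt_dec k (S i)) as [H|H].
      - replace (S i) with (k + (S i - k))%nat by lia; now apply Hmono.
      - pose proof (proj2 (Hmono (S i) (k - S i)%nat) i) as H1.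
        replace (S i + (k - S i))%nat with k in H1 by lia.
        symmetry; apply H1; destruct (Hu (S i)); lia. }
    destruct (HA de) as [k Hk].
    + specialize (Hde 0%nat); rewrite H0 in Hde; exact Hde.
    + destruct (Hu k) as (_ & _ & _ & H3); exact (H3 de (Hde (S k)) Hk).
Qed.

(** Finite prefixes occur as binary digits of numbers; this makes a union over all cylinders
    countable. *)
Lemma testbit_agree al n : exists c, agree n (Nat.testbit c) al.
Proof.
  revert al; induction n as [|n IH]; intros al; [exists 0%nat; intros i Hi; lia|].
  destruct (IH (fun i => al (S i))) as [c Hc].
  exists (2 * c + Nat.b2n (al 0%nat))%nat; intros [|i] Hi.
  - apply Nat.testbit_0_r.
  - rewrite Nat.testbit_succ_r; apply Hc; lia.
Qed.

(** For a set with the Baire property this amounts to being comeager in the cylinder; here it is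
    applied to sets not yet known to have that property. *)
Definition forces (A : (nat -> bool) -> Prop) (al : nat -> bool) (n : nat) : Prop :=
  forall be m, (n <= m)%nat -> agree n al be -> ~ meager (fun ga => agree m be ga /\ A ga).

Lemma forces_mono A al n be m :
  forces A al n -> (n <= m)%nat -> agree n al be -> forces A be m.
Proof.
  intros H Hnm Hab ga p Hp Hbg; apply H; [lia|].
  apply (agree_trans _ _ _ _ Hab); revert Hbg; apply agree_le; exact Hnm.
Qed.

(** A local form of the Banach category theorem. The part of [A] in those cylinders where it is
    meager is a countable union of meager sets; if no subcylinder forced [A], the points of the
    given cylinder outside all of those would be nowhere dense. *)
Lemma forces_exists A al n : ~ meager (fun ga => agree n al ga /\ A ga) ->
  exists be m, (n <= m)%nat /\ agree n al be /\ forces A be m.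
Proof.
  intros Hnm; apply NNPP; intros Hno; apply Hnm.
  set (C := fun N ga => agree (snd (of_nat N)) (Nat.testbit (fst (of_nat N))) ga).
  apply meager_sub with (fun ga =>
    (exists N, meager (fun ga => C N ga /\ A ga) /\ C N ga /\ A ga) \/
    (agree n al ga /\ forall N, C N ga -> ~ meager (fun ga => C N ga /\ A ga))).
  - intros ga [H1 H2]; destruct (classic (exists N, meager (fun ga => C N ga /\ A ga) /\ C N ga))
      as [(N & HN & HC)|H]; [left; exists N; auto|right].
    split; [exact H1|]; intros N HC HN; apply H; exists N; auto.
  - apply meager_or.
    + apply meager_union; intros N.
      destruct (classic (meager (fun ga => C N ga /\ A ga))) as [H|H].
      * revert H; apply meager_sub; intros ga (_ & H2); exact H2.
      * apply meager_nowhere_dense; intros be m; exists be, m; split; [lia|].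
        split; [intros i _; reflexivity|]; intros ga _ (H1 & _); contradiction.
    + apply meager_nowhere_dense; intros be m.
      destruct (classic (agree (Nat.min n m) al be)) as [Hab|Hab].
      2: { exists be, m; split; [lia|]; split; [intros i _; reflexivity|].
        intros ga Hga [H _]; apply Hab; intros i Hi.
        rewrite (H i), (Hga i) by lia; reflexivity. }
      (* The two cylinders are compatible in this case, and [be0] lies in both. *)
      set (be0 := fun i => if lt_dec i n then al i else be i).
      assert (H0 : agree m be be0).
      { intros i Hi; unfold be0; destruct lt_dec; [symmetry; apply Hab; lia|reflexivity]. }
      assert (H1 : agree n al be0).
      { intros i Hi; unfold be0; destruct lt_dec; [reflexivity|lia]. }
      destruct (classic (exists be' m', (Nat.max n m <= m')%nat /\ agree (Nat.max n m) be0 be' /\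
        meager (fun ga => agree m' be' ga /\ A ga))) as [(be' & m' & Hm' & Hb & HM)|H].
      * exists be', m'; split; [lia|]; split.
        { apply (agree_trans _ _ _ _ H0); revert Hb; apply agree_le; lia. }
        intros ga Hga [_ H2]; destruct (testbit_agree be' m') as [c Hc].
        apply (H2 (to_nat (c, m'))); unfold C; rewrite cancel_of_to; cbn [fst snd].
        { exact (agree_trans _ _ _ _ Hc Hga). }
        revert HM; apply meager_sub; intros ga' [H3 H4]; split; [|exact H4].
        refine (agree_trans _ _ _ _ _ H3); intros i Hi; symmetry; auto.
      * exfalso; apply Hno; exists be0, (Nat.max n m); split; [lia|]; split; [exact H1|].
        intros be' m' Hm' Hb HM; apply H; exists be', m'; auto.
Qed.

Definition flip (i : nat) (al : nat -> bool) : nat -> bool := upd al i (negb (al i)).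

Lemma flip_same i al : flip i al i = negb (al i).
Proof. apply upd_same. Qed.

Lemma flip_other i j al : j <> i -> flip i al j = al j.
Proof. apply upd_other. Qed.

Lemma meager_flip i A : meager A -> meager (fun al => A (flip i al)).
Proof.
  intros (E & HE & HA); exists (fun k al => E k (flip i al)); split.
  - intros k al n.
    (* Length at least [S i] makes the cylinder fix coordinate [i], so that flipping maps it to a
       cylinder. *)
    destruct (HE k (flip i al) (Nat.max n (S i))) as (be & m & Hm & Hab & H).
    exists (flip i be), m; split; [lia|]; split.
    + intros j Hj; destruct (Nat.eq_dec j i) as [->|Hne].
      * rewrite flip_same, <- Hab, flip_same, Bool.negb_involutive by lia; reflexivity.
      * rewrite flip_other, <- Hab, flip_other by lia; reflexivity.
    + intros ga Hga; apply H; intros j Hj; destruct (Nat.eq_dec j i) as [->|Hne].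
      * rewrite flip_same, <- Hga, flip_same, Bool.negb_involutive by lia; reflexivity.
      * rewrite flip_other, <- Hga, flip_other by lia; reflexivity.
  - intros al; apply HA.
Qed.

Section Projection.
Context {Y : Type} (code : nat -> Y -> nat).

(** A substitute for closedness when [Y] has no topology: stabilisation of all codes plays the part
    of convergence of the witnesses, and only the existence of a witness over the limit is
    demanded. *)
Definition complete_for (F : (nat -> bool) -> Y -> Prop) : Prop :=
  forall al als (ys : nat -> Y), (forall k, F (als k) (ys k)) ->
    (forall k, agree k al (als k)) ->
    (forall j k, (j <= k)%nat -> code j (ys k) = code j (ys j)) -> exists y, F al y.

Fixpoint prefix_code (k : nat) (y : Y) : nat :=
  match k with O => O | S k => to_nat (prefix_code k y, code k y) end.

(* The projection of a closed set has the Baire property: where each of the sets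
   [A k c] of points having a witness with prefix code [c] is forced, so is, outside a
   nowhere dense set, some [A (S k) c'] refining it; the witnesses found along a generic
   point converge. *)
Lemma projection_comeager F : complete_for F ->
  ~ meager (fun al => exists y, F al y) ->
  exists al n, meager (fun ga => agree n al ga /\ ~ exists y, F ga y).
Proof.
  intros HF Hnm.
  set (A := fun k c ga => exists y, F ga y /\ prefix_code k y = c).
  destruct (forces_exists (A 0%nat 0%nat) (fun _ => true) 0) as (be & m & _ & _ & Hf).
  { intros H; apply Hnm; revert H; apply meager_sub; intros ga [y Hy]; split;
      [intros i Hi; lia|exists y; auto]. }
  exists be, m.
  (* The exceptional points: some cylinder around them forces [A k c], but none forces a refinement
     by one more code. *)
  set (E := fun k c ga => (exists n, forces (A k c) ga n) /\
    ~ exists i n, forces (A (S k) (to_nat (c, i))) ga n).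
  exists (fun N => E (fst (of_nat N)) (snd (of_nat N))); split.
  - intros N; generalize (fst (of_nat N)) (snd (of_nat N)); intros k c al n.
    destruct (classic (exists be m, (n <= m)%nat /\ agree n al be /\ forces (A k c) be m))
      as [(be1 & m1 & Hm1 & Hab & Hf1)|Hno].
    (* [A k c] is the countable union of its refinements, so they cannot all be meager in this
       cylinder. *)
    + assert (Hi : exists i, ~ meager (fun ga => agree m1 be1 ga /\ A (S k) (to_nat (c, i)) ga)).
      { apply NNPP; intros H; apply (Hf1 be1 m1 (Nat.le_refl _) ltac:(intros i _; reflexivity)).
        apply meager_sub with
          (fun ga => exists i, agree m1 be1 ga /\ A (S k) (to_nat (c, i)) ga).
        - intros ga (Hga & y & Hy & Hc); exists (code k y); split; [exact Hga|].
          exists y; split; [exact Hy|]; simpl; now rewrite Hc.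
        - apply meager_union; intros i; apply NNPP; intros Hi; apply H; exists i; exact Hi. }
      destruct Hi as [i Hi]; apply forces_exists in Hi as (be2 & m2 & Hm2 & Hb2 & Hf2).
      exists be2, m2; split; [lia|]; split.
      * apply (agree_trans _ _ _ _ Hab); revert Hb2; apply agree_le; exact Hm1.
      * intros ga Hga [_ H]; apply H; exists i, m2.
        exact (forces_mono _ _ _ _ _ Hf2 (Nat.le_refl _) Hga).
    + exists al, n; split; [lia|]; split; [intros i _; reflexivity|].
      intros ga Hga [[p Hp] _]; apply Hno; exists ga, (Nat.max n p); split; [lia|].
      split; [exact Hga|]; apply (forces_mono _ _ _ _ _ Hp); [lia|intros i _; reflexivity].
  - intros ga [Hga Hny]; apply NNPP; intros HE; apply Hny.
    destruct (dependent_choice (fun k c => exists n, forces (A k c) ga n)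
      (fun k c c' => exists i, c' = to_nat (c, i)) 0%nat) as (u & Hu0 & Hu).
    + exists m; exact (forces_mono _ _ _ _ _ Hf (Nat.le_refl _) Hga).
    + intros k c Hc; apply NNPP; intros H; apply HE; exists (to_nat (k, c)).
      rewrite cancel_of_to; split; [exact Hc|]; intros (i & n & Hi); apply H.
      exists (to_nat (c, i)); split; eauto.
    (* A forced set is non-meager, hence non-empty, in a cylinder of length at least [k] around
       [ga]. The prefix of length [S k] is the one that contains the code of index [k]. *)
    + assert (Hy : forall k, exists ay : (nat -> bool) * Y, F (fst ay) (snd ay) /\
        agree k ga (fst ay) /\ prefix_code (S k) (snd ay) = u (S k)).
      { intros k; destruct (Hu (S k)) as [[n Hn] _]; apply NNPP; intros H.
        apply (Hn ga (Nat.max n k)); [lia|intros i _; reflexivity|].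
        exists (fun _ _ => False); split.
        - intros _ al p; exists al, p; repeat split; auto.
        - intros al (Hal & y & Hy & Hc); exfalso; apply H; exists (al, y); repeat split; auto.
          revert Hal; apply agree_le; lia. }
      apply choice in Hy as [ay Hay].
      assert (Hpre : forall y k j, prefix_code (j + k) y = u (j + k)%nat -> prefix_code k y = u k).
      { intros y k j; induction j as [|j IH]; intros Hj; [exact Hj|]; apply IH.
        destruct (Hu (j + k)%nat) as [_ [i Hi]]; cbn [Nat.add prefix_code] in Hj; rewrite Hi in Hj.
        apply to_nat_inj in Hj; congruence. }
      apply (HF ga (fun k => fst (ay k)) (fun k => snd (ay k))).
      * intros k; apply Hay.
      * intros k; apply Hay.
      * intros j k Hjk.
        assert (H1 : prefix_code (S j) (snd (ay k)) = prefix_code (S j) (snd (ay j))).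
        { destruct (Hay k) as (_ & _ & Hk), (Hay j) as (_ & _ & ->).
          apply (Hpre _ (S j) (k - j)%nat); replace (k - j + S j)%nat with (S k) by lia.
          exact Hk. }
        cbn [prefix_code] in H1; apply to_nat_inj in H1; congruence.
Qed.

(** Countably many classes cover the space, so one of them is non-meager and thus comeager in a
    cylinder of some length [m]. Flipping coordinate [m], the first free one, preserves the
    cylinder, and the meager exceptional set together with its flip cannot cover it. *)
Lemma flip_in_same_class (F : nat -> (nat -> bool) -> Y -> Prop) :
  (forall n, complete_for (F n)) -> (forall al, exists n y, F n al y) ->
  exists n al i, (exists y, F n al y) /\ exists y, F n (flip i al) y.
Proof.
  intros HF Hcov.
  assert (Hn : exists n, ~ meager (fun al => exists y, F n al y)).
  { apply NNPP; intros H; apply (not_meager_cylinder (fun _ => true) 0).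
    apply meager_sub with (fun al => exists n y, F n al y); [auto|].
    apply meager_union; intros n; apply NNPP; eauto. }
  destruct Hn as [n Hn]; destruct (projection_comeager (F n) (HF n) Hn) as (al & m & Hm).
  apply NNPP; intros Hno; apply (not_meager_cylinder al m).
  apply meager_sub with (2 := meager_or _ _ Hm (meager_flip m _ Hm)).
  intros ga Hga; destruct (classic (exists y, F n ga y)) as [H|H]; [right|left; auto].
  split.
  - intros i Hi; rewrite flip_other by lia; now apply Hga.
  - intros H'; apply Hno; exists n, ga, m; auto.
Qed.

End Projection.

(** * Countable codes for singular simplices *)

Fixpoint encode (l : list nat) : nat :=
  match l with nil => O | a :: l => S (to_nat (a, encode l)) end.

Lemma encode_inj l l' : encode l = encode l' -> l = l'.
Proof.
  revert l'; induction l as [|a l IH]; intros [|a' l']; cbn [encode]; intros H;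
    try discriminate; [reflexivity|].
  apply Nat.succ_inj, to_nat_inj in H; injection H as -> H; f_equal; auto.
Qed.

Definition zcode (z : Z) : nat := to_nat (Z.to_nat z, Z.to_nat (- z)).

Lemma zcode_inj z z' : zcode z = zcode z' -> z = z'.
Proof. unfold zcode; intros H; apply to_nat_inj in H; injection H; lia. Qed.

Lemma map_nth_seq {A : Type} (l : list A) (x : A) :
  l = map (fun i => nth i l x) (seq 0 (length l)).
Proof.
  induction l as [|a l IH]; [reflexivity|]; cbn [length seq map nth]; f_equal.
  rewrite <- seq_shift, map_map; exact IH.
Qed.

Lemma map_inj {A B : Type} (h : A -> B) (Hh : forall a a', h a = h a' -> a = a') l l' :
  map h l = map h l' -> l = l'.
Proof.
  revert l'; induction l as [|a l IH]; intros [|a' l']; simpl; intros H;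
    try discriminate; [reflexivity|].
  injection H as H1 H2; f_equal; auto.
Qed.

Lemma coef_bd2_map {A X : Type} (z : A -> Z) (u : A -> stdD2 -> X) l s :
  coef (bd2 (map (fun i => (z i, u i)) l)) s =
  zsum (fun i => (z i * (ind (fun t => u i (face0 t)) s - ind (fun t => u i (face1 t)) s
                          + ind (fun t => u i (face2 t)) s))%Z) l.
Proof.
  induction l as [|i l IH]; [reflexivity|].
  cbn [map]; rewrite coef_bd2_cons, IH; reflexivity.
Qed.

Section Codes.
Context {X : Type} (d : X -> X -> R) (hmet : is_metric d) (hcpt : metric_compact d).
Local Notation drefl := (met_refl d hmet).
Local Notation dsym := (met_sym d hmet).
Local Notation dtri := (met_tri d hmet).

Lemma finite_partition eps : 0 < eps ->
  exists v : X -> nat, forall x y, v x = v y -> d x y < eps.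
Proof.
  intros He; destruct (compact_cover d hmet hcpt (fun _ => eps / 2)) as [l Hl];
    [intros; lra|].
  assert (Hv : forall y, exists k, exists x, nth_error l k = Some x /\ d x y < eps / 2).
  { intros y; destruct (Hl y) as (x & Hx & Hd); apply In_nth_error in Hx as [k Hk].
    exists k, x; auto. }
  apply choice in Hv as [v Hv]; exists v; intros x y Hxy.
  destruct (Hv x) as (z & H1 & H2), (Hv y) as (z' & H1' & H2').
  rewrite Hxy, H1' in H1; injection H1 as ->.
  pose proof (dtri x z y); rewrite (dsym x z) in H; lra.
Qed.

(** The compactness theorem used concerns rectangles, so a gauge is also needed outside the
    triangle; there it is so small that no point of the triangle is in reach. *)
Lemma cont2_uniform (u : stdD2 -> X) eps : cont2 d u -> 0 < eps ->
  exists n, (0 < n)%nat /\ forall p p' : stdD2,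
    Rabs (fst (proj1_sig p') - fst (proj1_sig p)) <= / INR n ->
    Rabs (snd (proj1_sig p') - snd (proj1_sig p)) <= / INR n -> d (u p) (u p') < eps.
Proof.
  intros Hu He.
  assert (Hd : forall ab : R * R, exists de : posreal, forall p p' : stdD2,
    Rabs (fst (proj1_sig p) - fst ab) < de -> Rabs (snd (proj1_sig p) - snd ab) < de ->
    Rabs (fst (proj1_sig p') - fst ab) < 2 * de ->
    Rabs (snd (proj1_sig p') - snd ab) < 2 * de -> d (u p) (u p') < eps).
  { intros [a b]; cbn [fst snd].
    assert (Hout : forall de, 0 < de -> (forall p : stdD2,
      Rabs (fst (proj1_sig p) - a) < de -> Rabs (snd (proj1_sig p) - b) < de -> False) ->
      exists de : posreal, forall p p' : stdD2,
      Rabs (fst (proj1_sig p) - a) < de -> Rabs (snd (proj1_sig p) - b) < de ->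
      Rabs (fst (proj1_sig p') - a) < 2 * de -> Rabs (snd (proj1_sig p') - b) < 2 * de ->
      d (u p) (u p') < eps).
    { intros de Hde H; exists (mkposreal de Hde); simpl; intros p p' H1 H2.
      exfalso; exact (H p H1 H2). }
    destruct (Rlt_le_dec a 0) as [Ha|Ha].
    { apply (Hout (- a)); [lra|]; intros [[x y] (H1 & H2 & H3)] A1 A2; simpl in *.
      apply Rabs_def2 in A1; lra. }
    destruct (Rlt_le_dec b 0) as [Hb|Hb].
    { apply (Hout (- b)); [lra|]; intros [[x y] (H1 & H2 & H3)] A1 A2; simpl in *.
      apply Rabs_def2 in A2; lra. }
    destruct (Rlt_le_dec 1 (a + b)) as [Hab|Hab].
    { apply (Hout ((a + b - 1) / 2)); [lra|].
      intros [[x y] (H1 & H2 & H3)] A1 A2; simpl in *.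
      apply Rabs_def2 in A1, A2; lra. }
    destruct (Hu (exist _ (a, b) (conj Ha (conj Hb Hab))) (eps / 2)) as (de & Hde & H);
      [lra|]; cbn [proj1_sig fst snd] in H.
    assert (Hde2 : 0 < de / 2) by lra; exists (mkposreal (de / 2) Hde2); simpl.
    intros p p' H1 H2 H3 H4.
    pose proof (H p ltac:(lra) ltac:(lra)) as G1.
    pose proof (H p' ltac:(lra) ltac:(lra)) as G2.
    rewrite dsym in G2.
    set (q := u (exist _ (a, b) _)) in G1, G2.
    pose proof (dtri (u p) q (u p')); lra. }
  apply choice in Hd as [de Hde].
  destruct (compactness_value_2d 0 1 0 1 (fun a b => de (a, b))) as [d0 Hd0].
  destruct (archimed_cor1 d0 (cond_pos d0)) as (n & Hn & Hn0).
  exists n; split; [exact Hn0|]; intros p p' H1 H2.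
  assert (Hp1 : 0 <= fst (proj1_sig p) <= 1) by (destruct (proj2_sig p) as (? & ? & ?); lra).
  assert (Hp2 : 0 <= snd (proj1_sig p) <= 1) by (destruct (proj2_sig p) as (? & ? & ?); lra).
  apply NNPP; intros Hno; apply (Hd0 _ _ Hp1 Hp2).
  intros (a & b & _ & _ & A1 & A2 & A3); apply Hno; apply (Hde (a, b)); cbn [fst snd].
  - exact A1.
  - exact A2.
  - replace (fst (proj1_sig p') - a) with
      ((fst (proj1_sig p') - fst (proj1_sig p)) + (fst (proj1_sig p) - a)) by ring.
    apply Rle_lt_trans with (1 := Rabs_triang _ _); lra.
  - replace (snd (proj1_sig p') - b) with
      ((snd (proj1_sig p') - snd (proj1_sig p)) + (snd (proj1_sig p) - b)) by ring.
    apply Rle_lt_trans with (1 := Rabs_triang _ _); lra.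
Qed.

(** Rounding both coordinates down keeps the grid point inside the triangle. *)
Lemma grid_point (n : nat) (p : stdD2) : (0 < n)%nat ->
  exists i j, (i <= n)%nat /\ (j <= n)%nat /\ exists q : stdD2,
    proj1_sig q = (INR i / INR n, INR j / INR n) /\
    Rabs (fst (proj1_sig q) - fst (proj1_sig p)) <= / INR n /\
    Rabs (snd (proj1_sig q) - snd (proj1_sig p)) <= / INR n.
Proof.
  intros Hn; destruct p as [[x y] (Hx & Hy & Hxy)]; cbn [fst snd proj1_sig] in *.
  assert (Hn' : 0 < INR n) by now apply lt_0_INR.
  assert (Hg : forall w, 0 <= w <= 1 -> exists i, (i <= n)%nat /\
    0 <= INR i / INR n <= w /\ Rabs (INR i / INR n - w) <= / INR n).
  { intros w Hw; destruct (nfl_spec (w * INR n)) as [H1 H2]; [nra|].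
    set (i := nfl (w * INR n)) in *.
    assert (E : INR i / INR n * INR n = INR i) by (field; lra).
    assert (E' : / INR n * INR n = 1) by (field; lra).
    exists i; split; [apply INR_le; nra|]; split.
    - split; [apply Rdiv_le_0_compat; [apply pos_INR|lra]|].
      apply Rmult_le_reg_r with (INR n); lra.
    - rewrite Rabs_left1; apply Rmult_le_reg_r with (INR n); try lra; nra. }
  destruct (Hg x) as (i & Hi & Hix & Hi'); [lra|].
  destruct (Hg y) as (j & Hj & Hjy & Hj'); [lra|].
  exists i, j; split; [exact Hi|]; split; [exact Hj|].
  assert (Hq : 0 <= fst (INR i / INR n, INR j / INR n) /\
    0 <= snd (INR i / INR n, INR j / INR n) /\
    fst (INR i / INR n, INR j / INR n) + snd (INR i / INR n, INR j / INR n) <= 1)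
    by (cbn [fst snd]; lra).
  exists (exist _ (INR i / INR n, INR j / INR n) Hq); auto.
Qed.

(* The code of a simplex records a modulus of continuity and the pieces of a finite
   partition of the space that contain its values on the corresponding grid. *)
Lemma simplex_code eps : 0 < eps -> exists c : (stdD2 -> X) -> nat,
  forall u u', cont2 d u -> cont2 d u' -> c u = c u' -> forall p, d (u p) (u' p) <= eps.
Proof.
  intros He; destruct (finite_partition (eps / 3)) as [v Hv]; [lra|].
  assert (Hm : forall u : stdD2 -> X, exists n, cont2 d u -> (0 < n)%nat /\
    forall p p' : stdD2,
    Rabs (fst (proj1_sig p') - fst (proj1_sig p)) <= / INR n ->
    Rabs (snd (proj1_sig p') - snd (proj1_sig p)) <= / INR n -> d (u p) (u p') < eps / 3).
  { intros u; destruct (classic (cont2 d u)) as [Hu|Hu].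
    - destruct (cont2_uniform u (eps / 3) Hu) as [n Hn]; [lra|]; exists n; auto.
    - exists 0%nat; intros; contradiction. }
  apply choice in Hm as [m Hm].
  (* Grid positions outside the triangle get the value 0, so that the code runs over the whole
     square grid. *)
  set (val := fun (u : stdD2 -> X) (ij : nat * nat) =>
    match excluded_middle_informative (exists q : stdD2,
      proj1_sig q = (INR (fst ij) / INR (m u), INR (snd ij) / INR (m u))) with
    | left H => v (u (proj1_sig (constructive_indefinite_description _ H)))
    | right _ => O
    end).
  assert (Hval : forall u i j (q : stdD2), proj1_sig q = (INR i / INR (m u), INR j / INR (m u)) ->
    val u (i, j) = v (u q)).
  { intros u i j q Hq; unfold val; destruct excluded_middle_informative as [H|H].
    - destruct constructive_indefinite_description as [q' Hq']; cbn [proj1_sig fst snd] in *.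
      replace q' with q; [reflexivity|].
      destruct q as [q Hq1], q' as [q' Hq1']; cbn [proj1_sig] in *; subst q q'.
      f_equal; apply proof_irrelevance.
    - exfalso; apply H; exists q; exact Hq. }
  exists (fun u => to_nat (m u,
    encode (map (val u) (list_prod (seq 0 (S (m u))) (seq 0 (S (m u))))))).
  intros u u' Hu Hu' Hc p; apply to_nat_inj in Hc.
  pose proof (f_equal fst Hc) as Hmm; pose proof (f_equal snd Hc) as Hcc.
  cbn [fst snd] in Hmm, Hcc.
  apply encode_inj in Hcc; rewrite <- Hmm in Hcc.
  destruct (Hm u Hu) as [Hn Hu1], (Hm u' Hu') as [_ Hu1'].
  destruct (grid_point (m u) p Hn) as (i & j & Hi & Hj & q & Hq & Hq1 & Hq2).
  assert (Hvq : v (u q) = v (u' q)).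
  { rewrite <- (Hval u i j q Hq); rewrite <- (Hval u' i j q) by (rewrite <- Hmm; exact Hq).
    apply (ext_in_map Hcc); apply in_prod; apply in_seq; lia. }
  apply Hv in Hvq; specialize (Hu1 p q Hq1 Hq2).
  rewrite <- Hmm in Hu1'; specialize (Hu1' p q Hq1 Hq2); rewrite dsym in Hu1'.
  pose proof (dtri (u p) (u q) (u' p)); pose proof (dtri (u q) (u' q) (u' p)); lra.
Qed.

(* Far enough along the sequences, generators that coincide have the same limit, so
   that passing to the limit only merges generators. *)
Lemma zsum_limit (J : list (Z * (nat -> stdI -> X) * (stdI -> X))) :
  (forall j, In j J -> forall t eps, 0 < eps ->
    exists K, forall k, (K <= k)%nat -> d (snd (fst j) k t) (snd j t) < eps) ->
  (forall k s, zsum (fun j => (fst (fst j) * ind (snd (fst j) k) s)%Z) J = 0%Z) ->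
  forall s, zsum (fun j => (fst (fst j) * ind (snd j) s)%Z) J = 0%Z.
Proof.
  intros Hlim Hz s.
  assert (Hsep : forall jj : (Z * (nat -> stdI -> X) * (stdI -> X)) *
                             (Z * (nat -> stdI -> X) * (stdI -> X)),
    exists K, forall k, (K <= k)%nat -> In (fst jj) J -> In (snd jj) J ->
      snd (fst (fst jj)) k = snd (fst (snd jj)) k -> snd (fst jj) = snd (snd jj)).
  { intros [j j']; cbn [fst snd].
    destruct (classic (In j J /\ In j' J /\ snd j <> snd j')) as [(Hj & Hj' & Hne)|H].
    2: { exists 0%nat; intros k _ Hj Hj' _; apply NNPP; intros Hne; apply H; auto. }
    assert (Ht : exists t, snd j t <> snd j' t).
    { apply NNPP; intros H; apply Hne, functional_extensionality; intros t.
      apply NNPP; intros Ht; apply H; exists t; exact Ht. }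
    destruct Ht as [t Ht].
    assert (Hpos : 0 < d (snd j t) (snd j' t)).
    { destruct (Rle_lt_or_eq_dec _ _ (met_pos d hmet (snd j t) (snd j' t))) as [H|H]; [exact H|].
      exfalso; apply Ht; apply (met_eq d hmet); auto. }
    destruct (Hlim j Hj t (d (snd j t) (snd j' t) / 2)) as [K HK]; [lra|].
    destruct (Hlim j' Hj' t (d (snd j t) (snd j' t) / 2)) as [K' HK']; [lra|].
    exists (Nat.max K K'); intros k Hk _ _ E; exfalso.
    specialize (HK k ltac:(lia)); specialize (HK' k ltac:(lia)); rewrite <- E in HK'.
    pose proof (dtri (snd j t) (snd (fst j) k t) (snd j' t)) as T.
    rewrite (dsym (snd j t) (snd (fst j) k t)) in T; lra. }
  apply choice in Hsep as [K HK].
  destruct (list_bound K (list_prod J J)) as [M HM].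
  (* [F] selects the generators at stage [M] whose limit is [s]; by the choice of [M] this depends
     on the generator alone, so the linear extension of [F] computes the limit coefficient from
     stage [M]. *)
  set (F := fun x : stdI -> X =>
    if excluded_middle_informative (exists j, In j J /\ snd (fst j) M = x /\ snd j = s)
    then 1%Z else 0%Z).
  pose proof (zsum_coef_zero F (map (fun j => (fst (fst j), snd (fst j) M)) J)) as H.
  rewrite zsum_map in H; cbn [fst snd] in H; rewrite <- H.
  - apply zsum_ext; intros j Hj; f_equal; unfold F.
    destruct excluded_middle_informative as [(j' & Hj' & E & Es)|Hno].
    + assert (Ej : snd j' = snd j)
        by (apply (HK (j', j) M); auto; apply HM; now apply in_prod).
      rewrite <- Ej, Es; apply ind_same.
    + apply ind_diff; intros Es; apply Hno; exists j; auto.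
  - intros x; rewrite coef_zsum, zsum_map; cbn [fst snd]; apply Hz.
Qed.

(** One sequence of codes serves all chains [c]. Index 0 records the coefficients and index [S k]
    the simplices up to 2^-k, so stabilising codes mean fixed coefficients and uniformly convergent
    simplices. The hypothesis on [gam] gives pointwise convergence of the bounded loops. *)
Lemma bounding_chain_closed (gam : (nat -> bool) -> stdI -> X) :
  (forall al t, exists K, forall be, agree K al be -> gam be t = gam al t) ->
  exists code : nat -> chain2 X -> nat, forall c : chain1 X,
    complete_for code (fun al b => is_chain2 d b /\
      forall s, (coef [(1%Z, gam al)] s - coef c s)%Z = coef (bd2 b) s).
Proof.
  intros Hgam.
  assert (Hc : forall k, exists c : (stdD2 -> X) -> nat, forall u u', cont2 d u ->
    cont2 d u' -> c u = c u' -> forall p, d (u p) (u' p) <= (1 / 2) ^ k)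
    by (intros k; apply simplex_code, half_pow_pos).
  apply choice in Hc as [sc Hsc].
  exists (fun k b => encode (match k with
    | O => map (fun p => zcode (fst p)) b
    | S k => map (fun p => sc k (snd p)) b end)).
  intros c al als ys HF Hag Hcode.
  set (dflt := (0%Z, fun _ : stdD2 => gam al I0)).
  set (N := length (ys 0%nat)).
  set (z := fun i => fst (nth i (ys 0%nat) dflt)).
  set (sg := fun k i => snd (nth i (ys k) dflt)).
  assert (Hfst : forall k, map fst (ys k) = map fst (ys 0%nat)).
  { intros k; apply (map_inj zcode zcode_inj); rewrite !map_map.
    exact (encode_inj _ _ (Hcode 0%nat k (Nat.le_0_l k))). }
  assert (Hys : forall k, ys k = map (fun i => (z i, sg k i)) (seq 0 N)).
  { intros k; rewrite (map_nth_seq (ys k) dflt) at 1.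
    replace (length (ys k)) with N
      by (unfold N; rewrite <- (length_map fst (ys k)), Hfst, length_map; reflexivity).
    apply map_ext; intros i; unfold z, sg.
    rewrite <- (map_nth fst), <- (Hfst k), map_nth; apply surjective_pairing. }
  assert (Hsg : forall k i, cont2 d (sg k i)).
  { intros k i; unfold sg; destruct (nth_in_or_default i (ys k) dflt) as [H|H].
    - exact (proj1 (HF k) _ H).
    - rewrite H; intros p eps He; exists 1; split; [lra|]; intros; simpl; rewrite drefl; exact He. }
  assert (Hcauchy : forall i p k, d (sg (S k) i p) (sg (S (S k)) i p) <= (1 / 2) ^ k).
  { intros i p k; apply Hsc; auto; unfold sg.
    pose proof (encode_inj _ _ (Hcode (S k) (S (S k)) (Nat.le_succ_diag_r _))) as E.
    rewrite <- !(map_nth (fun p => sc k (snd p))); rewrite E; reflexivity. }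
  assert (Hlim : forall ip : nat * stdD2, exists x, forall k,
    d (sg (S k) (fst ip) (snd ip)) x <= 2 * 1 * (1 / 2) ^ k).
  { intros [i p]; apply (geometric_limit d hmet hcpt (fun k => sg (S k) i p)); [lra|].
    intros k; rewrite Rmult_1_l; apply Hcauchy. }
  apply choice in Hlim as [lim Hlim].
  set (tau := fun i p => lim (i, p)).
  assert (Htau : forall i p k, d (sg (S k) i p) (tau i p) <= 2 * (1 / 2) ^ k).
  { intros i p k; specialize (Hlim (i, p) k); cbn [fst snd] in Hlim.
    rewrite Rmult_1_r in Hlim; exact Hlim. }
  assert (Hconv : forall i p eps, 0 < eps -> exists K, forall k, (K <= k)%nat ->
    d (sg (S k) i p) (tau i p) < eps).
  { intros i p eps He; destruct (half_pow_small 2 eps) as [K HK]; [lra|exact He|].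
    exists K; intros k Hk; apply Rle_lt_trans with (1 := Htau i p k).
    apply Rle_lt_trans with (2 := HK); apply Rmult_le_compat_l; [lra|].
    replace k with (K + (k - K))%nat by lia; rewrite pow_add.
    rewrite <- (Rmult_1_r ((1 / 2) ^ K)) at 2; apply Rmult_le_compat_l;
      [left; apply half_pow_pos|].
    apply Rle_trans with (1 ^ (k - K)); [apply pow_incr; lra|rewrite pow1; lra]. }
  exists (map (fun i => (z i, tau i)) (seq 0 N)); split.
  - intros q Hq; apply in_map_iff in Hq as (i & <- & _); cbn [snd]; intros p eps He.
    (* Two uniform errors of 2/2^k must together stay below two thirds of [eps], hence the factor
       6. *)
    destruct (half_pow_small 6 eps) as [k Hk]; [lra|exact He|].
    destruct (Hsg (S k) i p (eps / 3)) as (de & Hde & H); [lra|].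
    exists de; split; [exact Hde|]; intros p' H1 H2; specialize (H p' H1 H2).
    pose proof (Htau i p k) as A1; pose proof (Htau i p' k) as A2; rewrite dsym in A2.
    pose proof (dtri (tau i p') (sg (S k) i p') (tau i p)) as T1.
    pose proof (dtri (sg (S k) i p') (sg (S k) i p) (tau i p)) as T2; lra.
  - intros s; rewrite coef_bd2_map.
    (* [J] lists all terms of the equation, moved to one side, each with its approximations and its
       limit; [Hsum] evaluates either version. *)
    set (J := ((1%Z, fun k => gam (als (S k)), gam al) ::
      map (fun p => ((- fst p)%Z, fun _ : nat => snd p, snd p)) c ++
      flat_map (fun i =>
        [((- z i)%Z, fun k t => sg (S k) i (face0 t), fun t => tau i (face0 t));
         (z i, fun k t => sg (S k) i (face1 t), fun t => tau i (face1 t));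
         ((- z i)%Z, fun k t => sg (S k) i (face2 t), fun t => tau i (face2 t))])
        (seq 0 N)) : list (Z * (nat -> stdI -> X) * (stdI -> X))).
    assert (Hsum : forall (g : Z * (nat -> stdI -> X) * (stdI -> X) -> stdI -> X) s,
      (forall p, g ((- fst p)%Z, fun _ : nat => snd p, snd p) = snd p) ->
      zsum (fun j => (fst (fst j) * ind (g j) s)%Z) J =
      (ind (g (1%Z, fun k => gam (als (S k)), gam al)) s - coef c s
       - zsum (fun i => (z i *
           (ind (g ((- z i)%Z, fun k t => sg (S k) i (face0 t), fun t => tau i (face0 t))) s
          - ind (g (z i, fun k t => sg (S k) i (face1 t), fun t => tau i (face1 t))) s
          + ind (g ((- z i)%Z, fun k t => sg (S k) i (face2 t), fun t => tau i (face2 t))) s))%Z)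
           (seq 0 N))%Z).
    { intros g s' Hg; unfold J; rewrite zsum_cons, zsum_app, zsum_map, zsum_flat_map.
      cbn [fst snd zsum fold_right].
      rewrite (zsum_ext _ (fun p => (-1 * (fst p * ind (snd p) s'))%Z) c)
        by (intros; rewrite Hg; ring).
      rewrite zsum_scal, <- coef_zsum.
      rewrite (zsum_ext _ (fun i => (-1 * (z i *
           (ind (g ((- z i)%Z, fun k t => sg (S k) i (face0 t), fun t => tau i (face0 t))) s'
          - ind (g (z i, fun k t => sg (S k) i (face1 t), fun t => tau i (face1 t))) s'
          + ind (g ((- z i)%Z, fun k t => sg (S k) i (face2 t), fun t => tau i (face2 t))) s')))%Z)
          (seq 0 N)) by (intros; ring).
      rewrite zsum_scal; ring. }
    pose proof (zsum_limit J) as HJ.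
    assert (HJs : zsum (fun j => (fst (fst j) * ind (snd j) s)%Z) J = 0%Z).
    { apply HJ; clear HJ.
      - intros j [<-|Hj] t eps He; cbn [fst snd].
        + destruct (Hgam al t) as [K HK]; exists K; intros k Hk.
          rewrite (HK (als (S k))), drefl; [exact He|].
          apply agree_le with (S k); [lia|apply Hag].
        + apply in_app_or in Hj as [Hj|Hj].
          * apply in_map_iff in Hj as (p & <- & _); cbn [fst snd]; exists 0%nat.
            intros; rewrite drefl; exact He.
          * apply in_flat_map in Hj as (i & _ & [<-|[<-|[<-|[]]]]); cbn [fst snd];
              apply Hconv; exact He.
      - intros k s'; rewrite (Hsum (fun j => snd (fst j) k)) by reflexivity; cbn [fst snd].
        destruct (HF (S k)) as [_ E]; specialize (E s').
        rewrite Hys, coef_bd2_map, coef_cons, coef_nil in E; lia. }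
    rewrite (Hsum snd) in HJs by reflexivity; cbn [fst snd] in HJs.
    rewrite coef_cons, coef_nil; lia.
Qed.

End Codes.

(** * Infinite concatenations of small loops *)

Section Concatenation.
Context {X : Type} (d : X -> X -> R) (hmet : is_metric d).
Local Notation drefl := (met_refl d hmet).
Local Notation dsym := (met_sym d hmet).
Local Notation dtri := (met_tri d hmet).

Context (x : X) (f : nat -> R -> X).
Context (Hf : forall n, cpath d (f n)) (Hf0 : forall n, f n 0 = x)
        (Hf1 : forall n, f n 1 = x) (Hfs : forall n t, d x (f n t) < (1 / 2) ^ n).

(* The loop [f n] run on the interval [1/(n+2), 1/(n+1)] and constant outside. *)
Definition placed (n : nat) (t : R) : X :=
  f n (clamp (- (INR n + 1) + t * ((INR n + 1) * (INR n + 2)))).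

Lemma placed_cpath n : cpath d (placed n).
Proof. apply (cpath_affine d (fun t => f n (clamp t))), cpath_clamp, Hf. Qed.

Lemma placed_support n t : placed n t <> x -> 1 < t * (INR n + 2) /\ t * (INR n + 1) < 1.
Proof.
  unfold placed; intros H; pose proof (pos_INR n) as Hn.
  set (w := - (INR n + 1) + t * ((INR n + 1) * (INR n + 2))) in *.
  destruct (Rle_or_lt w 0) as [H0|H0];
    [exfalso; apply H; rewrite clamp_le0 by exact H0; apply Hf0|].
  destruct (Rle_or_lt 1 w) as [H1|H1];
    [exfalso; apply H; rewrite clamp_ge1 by exact H1; apply Hf1|].
  unfold w in H0, H1; split.
  - apply Rmult_lt_reg_r with (INR n + 1); lra.
  - apply Rmult_lt_reg_r with (INR n + 2); lra.
Qed.

Lemma placed_disjoint n m t : placed n t <> x -> placed m t <> x -> n = m.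
Proof.
  assert (Hlt : forall n m, (n < m)%nat -> placed n t <> x -> placed m t <> x -> False).
  { clear n m; intros n m Hnm H1 H2; apply placed_support in H1, H2.
    assert (H : INR (S n) <= INR m) by (apply le_INR; lia); rewrite S_INR in H.
    pose proof (pos_INR n).
    assert (0 < t) by (apply Rmult_lt_reg_r with (INR n + 2); lra). nra. }
  intros H1 H2; destruct (Nat.lt_trichotomy n m) as [H|[H|H]]; [|exact H|];
    exfalso; eapply Hlt; eauto.
Qed.

Lemma placed_outside i n t : / (INR i + 2) <= t <= / (INR i + 1) -> n <> i -> placed n t = x.
Proof.
  intros [Hl Hr] Hne; apply NNPP; intros H; apply placed_support in H as [H1 H2].
  pose proof (pos_INR i); pose proof (pos_INR n).
  assert (A1 : 1 <= t * (INR i + 2)).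
  { apply Rmult_le_compat_r with (r := INR i + 2) in Hl; [|lra].
    rewrite Rinv_l in Hl by lra; exact Hl. }
  assert (A2 : t * (INR i + 1) <= 1).
  { apply Rmult_le_compat_r with (r := INR i + 1) in Hr; [|lra].
    rewrite Rinv_l in Hr by lra; exact Hr. }
  assert (Ht : 0 < t) by (apply Rmult_lt_reg_r with (INR i + 2); lra).
  destruct (Nat.lt_trichotomy n i) as [Hni|[Hni|Hni]]; [|contradiction|].
  - assert (A3 : INR (S n) <= INR i) by (apply le_INR; lia); rewrite S_INR in A3; nra.
  - assert (A3 : INR (S i) <= INR n) by (apply le_INR; lia); rewrite S_INR in A3; nra.
Qed.

(** Where all placed loops are at [x], the arbitrary value chosen is harmless: both branches of
    [infinite_concat] then give [x]. *)
Definition active (t : R) : nat := epsilon (inhabits 0%nat) (fun n => placed n t <> x).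

Lemma placed_inactive n t : n <> active t -> placed n t = x.
Proof.
  intros Hn; apply NNPP; intros H; apply Hn; apply (placed_disjoint n _ t H).
  unfold active; apply epsilon_spec; exists n; exact H.
Qed.

Definition infinite_concat (al : nat -> bool) (t : R) : X :=
  if al (active t) then placed (active t) t else x.

(** Only finitely many loops can leave the ball of radius eps/2 around [x], and these are continuous
    at t simultaneously. If the active loop changes between two parameters, each value is compared
    with the value [x] of the same loop at the other parameter. *)
Lemma concat_cpath al : cpath d (infinite_concat al).
Proof.
  set (h := fun n t => if al n then placed n t else x).
  assert (Hh : forall n, cpath d (h n)).
  { intros n; unfold h; destruct (al n); [apply placed_cpath|now apply cpath_const]. }
  assert (Hhx : forall n t, n <> active t -> h n t = x).
  { intros n t Hn; unfold h; destruct (al n); [now apply placed_inactive|reflexivity]. }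
  assert (Hhs : forall n t, d x (h n t) < (1 / 2) ^ n).
  { intros n t; unfold h; destruct (al n); [apply Hfs|rewrite drefl; apply half_pow_pos]. }
  intros t eps He; destruct (half_pow_small 1 (eps / 2)) as [M HM]; [lra|lra|].
  rewrite Rmult_1_l in HM.
  assert (Hsmall : forall n t, (M <= n)%nat -> d x (h n t) < eps / 2).
  { intros n t0 Hn; apply Rlt_le_trans with (1 := Hhs n t0); apply Rlt_le in HM.
    apply Rle_trans with (2 := HM).
    replace n with (M + (n - M))%nat by lia; rewrite pow_add.
    rewrite <- (Rmult_1_r ((1 / 2) ^ M)) at 2; apply Rmult_le_compat_l;
      [left; apply half_pow_pos|].
    apply Rle_trans with (1 ^ (n - M)); [apply pow_incr; lra|rewrite pow1; lra]. }
  assert (Hde : exists de, 0 < de /\ forall n t', (n < M)%nat -> Rabs (t' - t) < de ->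
    d (h n t') (h n t) < eps / 2).
  { clear HM Hsmall; induction M as [|M (de & Hde & H)]; [exists 1; split; [lra|intros; lia]|].
    destruct (Hh M t (eps / 2)) as (de' & Hde' & H'); [lra|].
    exists (Rmin de de'); split; [now apply Rmin_pos|]; intros n t' Hn Ht.
    destruct (Nat.eq_dec n M) as [->|Hne].
    - apply H'; eapply Rlt_le_trans; [exact Ht|apply Rmin_r].
    - apply H; [lia|]; eapply Rlt_le_trans; [exact Ht|apply Rmin_l]. }
  destruct Hde as (de & Hde & H); exists de; split; [exact Hde|]; intros t' Ht.
  change (d (h (active t') t') (h (active t) t) < eps).
  set (n' := active t'); set (n := active t).
  destruct (Nat.eq_dec n' n) as [E|E].
  - rewrite E; destruct (le_lt_dec M n) as [Hn|Hn].
    + pose proof (dtri (h n t') x (h n t)) as T; rewrite (dsym (h n t') x) in T.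
      pose proof (Hsmall n t' Hn); pose proof (Hsmall n t Hn); lra.
    + specialize (H n t' Hn Ht); lra.
  - assert (B1 : d x (h n' t') < eps / 2).
    { destruct (le_lt_dec M n') as [Hn|Hn]; [auto|].
      specialize (H n' t' Hn Ht); rewrite (Hhx n' t), dsym in H by exact E; exact H. }
    assert (B2 : d x (h n t) < eps / 2).
    { destruct (le_lt_dec M n) as [Hn|Hn]; [auto|].
      specialize (H n t' Hn Ht); rewrite (Hhx n t') in H by (intros ->; now apply E).
      exact H. }
    pose proof (dtri (h n' t') x (h n t)) as T; rewrite (dsym (h n' t') x) in T; lra.
Qed.

Lemma concat_on_interval al i t : / (INR i + 2) <= t <= / (INR i + 1) ->
  infinite_concat al t = if al i then placed i t else x.
Proof.
  intros Ht; unfold infinite_concat; destruct (Nat.eq_dec (active t) i) as [->|Hne]; [reflexivity|].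
  rewrite (placed_outside i _ t Ht Hne), (placed_inactive i t) by auto.
  destruct (al (active t)), (al i); reflexivity.
Qed.

Lemma concat_flip al i t : placed i t = x -> infinite_concat (flip i al) t = infinite_concat al t.
Proof.
  intros H; unfold infinite_concat; destruct (Nat.eq_dec (active t) i) as [->|Hne].
  - rewrite H; destruct (flip i al i), (al i); reflexivity.
  - now rewrite flip_other.
Qed.

Lemma placed_left i t : t <= / (INR i + 2) -> placed i t = x.
Proof.
  intros Ht; apply NNPP; intros H; apply placed_support in H as [H _].
  pose proof (pos_INR i); apply Rmult_le_compat_r with (r := INR i + 2) in Ht; [|lra].
  rewrite Rinv_l in Ht by lra; lra.
Qed.

Lemma placed_right i t : / (INR i + 1) <= t -> placed i t = x.
Proof.
  intros Ht; apply NNPP; intros H; apply placed_support in H as [_ H].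
  pose proof (pos_INR i); apply Rmult_le_compat_r with (r := INR i + 1) in Ht; [|lra].
  rewrite Rinv_l in Ht by lra; lra.
Qed.

(** Both loops are cut at the ends of the interval carrying [f i]. The outer pieces coincide, and
    the middle ones are [f i] and a constant simplex, which bounds. *)
Lemma loop_bounds_of_flip al i : al i = true ->
  Bd d (fun s => (ind (seg (infinite_concat al) 0 1) s
                  - ind (seg (infinite_concat (flip i al)) 0 1) s)%Z) ->
  Bd d (ind (seg (f i) 0 1)).
Proof.
  intros Hal HB; pose proof (pos_INR i) as Hi.
  set (a := / (INR i + 2)); set (b := / (INR i + 1)).
  assert (Ha : 0 < a) by (apply Rinv_0_lt_compat; lra).
  assert (Hab : a < b) by (apply Rinv_lt_contravar; nra).
  assert (Hb1 : b <= 1) by (unfold b; rewrite <- Rinv_1; apply Rinv_le_contravar; lra).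
  set (g := infinite_concat al) in *; set (g' := infinite_concat (flip i al)) in *.
  assert (E1 : seg g' 0 a = seg g 0 a).
  { apply seg_ext; intros t Ht; apply concat_flip, placed_left; fold a; nra. }
  assert (E3 : seg g' b 1 = seg g b 1).
  { apply seg_ext; intros t Ht; apply concat_flip, placed_right; fold b; nra. }
  assert (E2 : seg g a b = seg (f i) 0 1).
  { apply seg_ext; intros t Ht; unfold g; rewrite (concat_on_interval al i), Hal.
    - unfold placed; f_equal; rewrite <- (clamp_id (0 + t * (1 - 0))) by lra; f_equal.
      unfold a, b; field; lra.
    - fold a b; nra. }
  assert (E2' : seg g' a b = fun _ => x).
  { apply functional_extensionality; intros [t Ht]; unfold seg, g'; cbn [proj1_sig].
    rewrite (concat_on_interval _ i) by (fold a b; nra).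
    now rewrite flip_same, Hal. }
  assert (Hg : cpath d g) by apply concat_cpath.
  assert (Hg' : cpath d g') by apply concat_cpath.
  pose proof (Bd_add d _ _ (Bd_triangle d g 0 a b Hg) (Bd_triangle d g 0 b 1 Hg)) as T.
  pose proof (Bd_add d _ _ (Bd_triangle d g' 0 a b Hg') (Bd_triangle d g' 0 b 1 Hg')) as T'.
  rewrite E1, E2', E3 in T'; rewrite E2 in T.
  apply (Bd_ext d _ _ (Bd_add d _ _ (Bd_add d _ _ (Bd_sub d _ _ T T') HB)
    (Bd_const d hmet x))); intros s; ring.
Qed.

End Concatenation.

Lemma uncountable_of_small_loops {X : Type} (d : X -> X -> R) :
  is_metric d -> metric_compact d -> ~ small_loops_bound d -> ~ H1_countable d.
Proof.
  intros hmet hcpt Hno [h Hh]; apply not_all_ex_not in Hno as [x Hx].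
  assert (Hloop : forall n : nat, exists f : R -> X, cpath d f /\ f 0 = x /\ f 1 = x /\
    (forall t, d x (f t) < (1 / 2) ^ n) /\ ~ Bd d (ind (seg f 0 1))).
  { intros n; apply NNPP; intros Hn; apply Hx; exists ((1 / 2) ^ n).
    split; [apply half_pow_pos|]; intros f Hf H0 H1 Hs; apply NNPP; intros HB.
    apply Hn; exists f; auto. }
  apply choice in Hloop as [f Hf].
  assert (Hcp : forall al, cpath d (infinite_concat x f al))
    by (intros al; apply (concat_cpath d hmet x f); intros; apply Hf).
  set (gam := fun al => seg (infinite_concat x f al) 0 1).
  destruct (bounding_chain_closed d hmet hcpt gam) as [code Hcode].
  { intros al t; set (n := active x f (0 + proj1_sig t * (1 - 0))).
    exists (S n); intros be Hbe; unfold gam, seg, infinite_concat; fold n.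
    now rewrite (Hbe n) by lia. }
  destruct (flip_in_same_class code
    (fun n al b => is_chain2 d b /\
      forall s, (coef [(1%Z, gam al)] s - coef (h n) s)%Z = coef (bd2 b) s))
    as (n & al & i & Hb & Hb').
  - intros n; apply Hcode.
  - intros al; destruct (Hh [(1%Z, gam al)]) as (n & _ & b & Hb); [|exists n, b; exact Hb].
    split; [intros p [<-|[]]; apply cont1_seg, Hcp|]; intros y.
    change (coef [(1%Z, gam al I1); ((- 1)%Z, gam al I0)] y = 0%Z).
    replace (gam al I1) with (gam al I0); [rewrite !coef_cons, coef_nil; ring|].
    assert (Hend : forall t, t = 0 \/ t = 1 -> infinite_concat x f al t = x).
    { intros t Ht; unfold infinite_concat; destruct (al _); [|reflexivity].
      apply NNPP; intros Hp.
      apply (placed_support x f) in Hp; [|intros; apply Hf|intros; apply Hf].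
      pose proof (pos_INR (active x f t)); destruct Ht as [-> | ->]; lra. }
    unfold gam, seg; cbn [proj1_sig I0 I1].
    rewrite !Hend; [reflexivity|right; ring|left; ring].
  (* Both loops are homologous to the same [h n], which drops out of the difference. *)
  - assert (HBd : Bd d (fun s => (ind (gam al) s - ind (gam (flip i al)) s)%Z)).
    { apply (Bd_ext d _ _ (Bd_sub d _ _ Hb Hb')); intros s.
      rewrite !coef_cons, coef_nil; ring. }
    assert (Hmain : forall be, be i = true ->
      ~ Bd d (fun s => (ind (gam be) s - ind (gam (flip i be)) s)%Z)).
    { intros be Hbe HB; apply (proj2 (proj2 (proj2 (proj2 (Hf i))))).
      refine (loop_bounds_of_flip d hmet x f _ _ _ _ be i Hbe HB); intros; apply Hf. }
    (* If coordinate [i] is off in [al], the roles of [al] and its flip are exchanged. *)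
    destruct (al i) eqn:Hai; [exact (Hmain al Hai HBd)|].
    apply (Hmain (flip i al)); [now rewrite flip_same, Hai|].
    assert (Hff : flip i (flip i al) = al).
    { apply functional_extensionality; intros j; destruct (Nat.eq_dec j i) as [->|Hne].
      - rewrite !flip_same; apply Bool.negb_involutive.
      - now rewrite !flip_other. }
    rewrite Hff; apply (Bd_ext d _ _ (Bd_scal d (-1) _ HBd)); intros s; ring.
Qed.

Theorem theorem1p1 (X : Type) (d : X -> X -> R)
  (hmet : is_metric d) (hcpt : metric_compact d) (hlc : locally_connected d) :
  ~ H1_countable d \/ H1_finite_sum_of_cyclic d.
Proof.
  destruct (classic (small_loops_bound d)) as [H|H].
  - right; now apply finite_sum_of_cyclic.
  - left; now apply uncountable_of_small_loops.
Qed.
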